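(* Let $P(\lambda) := \sum_{j=0}^m \lambda^j A_j$ with $m\ge 1$, $A_j \in \mathbb{C}^{n\times n}$ and $\operatorname{rank}(A_m)=n$, let $\mathbb{S} = \{\lambda_1,\dots,\lambda_s\}$ be a set of $s$ complex scalars, and let $r$ be a positive integer. For $\mu=(\mu_1,\dots,\mu_r)\in\mathbb{S}^r$ and $\Gamma=(\gamma_{ik})_{1\le k<i\le r}\in\mathbb{C}^{r(r-1)/2}$ let $\mathcal{Q}(\mu,\Gamma,P)\in\mathbb{C}^{nr\times nr}$ be the block lower triangular matrix whose $n\times n$ submatrix at rows $1+(i-1)n,\dots,in$ and columns $1+(\ell-1)n,\dots,\ell n$ is $$\begin{cases}\displaystyle\sum_{(s_0,s_1,\dots,s_k)}\gamma_{s_1s_0}\gamma_{s_2s_1}\cdots\gamma_{s_ks_{k-1}}\,P[\mu_{s_0},\dots,\mu_{s_k}] & i>\ell,\\ P(\mu_i) & i=\ell,\\ 0 & i<\ell,\end{cases}$$ where the sum is over all (strictly) increasing sequences of positive integers $(s_0,\dots,s_k)$ (of any length) with $s_0=\ell$ and $s_k=i$. Let $\mu_\ast\in\mathbb{S}^r$ be a point attaining $\inf_{\mu\in\mathbb{S}^r}\sup_{\Gamma\in\mathbb{C}^{r(r-1)/2}}\sigma_{-r}(\mathcal{Q}(\mu,\Gamma,P))$ and $\Gamma_\ast$ a point attaining the inner supremum for $\mu=\mu_\ast$ (if $r>n$, it is assumed that this inner supremum is attained), and suppose that the multiplicity assumption and the linear independence assumption hold at $(\mu_\ast,\Gamma_\ast)$.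 Then $$\tau_r(\mathbb{S}) = \inf_{\mu\in\mathbb{S}^r}\ \sup_{\Gamma\in\mathbb{C}^{r(r-1)/2}} \sigma_{-r}\left(\mathcal{Q}(\mu,\Gamma,P)\right).$$
   Context: For $\Delta\in\mathbb{C}^{n\times n}$, $P+\Delta$ denotes the matrix polynomial $\lambda\mapsto P(\lambda)+\Delta$, and $m_j(P+\Delta)$ is the algebraic multiplicity of $\lambda_j$ as an eigenvalue of $P+\Delta$, i.e. the multiplicity of $\lambda_j$ as a root of $\det(P(\lambda)+\Delta)$ (zero if it is not a root). The distance is $$\tau_r(\mathbb{S}) := \inf\Big\{\|\Delta\|_2 : \Delta\in\mathbb{C}^{n\times n},\ \sum_{j=1}^s m_j(P+\Delta)\ge r\Big\}.$$ $\mathbb{S}^r$ is the set of $r$-tuples with entries in $\mathbb{S}$. $\sigma_{-k}(\cdot)$ denotes the $k$th smallest singular value (counted with multiplicity). Divided differences: $P[x_0]=P(x_0)$ and, for nodes $x_0,\dots,x_k$ in which equal nodes are contiguous, $$P[x_0,\dots,x_k]=\begin{cases}\dfrac{P[x_1,\dots,x_k]-P[x_0,\dots,x_{k-1}]}{x_k-x_0} & x_0\neq x_k,\\[2mm] \dfrac{P^{(k)}(x_0)}{k!} & x_0=x_k.\end{cases}$$ Divided differences do not depend on the order of the nodes; if equal nodes are not contiguous, the nodes are reordered so that they are. Multiplicity assumption at $(\mu_\ast,\Gamma_\ast)$: the multiplicity of the singular value $\sigma_{-r}(\mathcal{Q}(\mu_\ast,\Gamma_\ast,P))$ is one. Linear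 independence assumption at $(\mu_\ast,\Gamma_\ast)$: if $U,V\in\mathbb{C}^{nr}$ is a consistent pair of unit left and right singular vectors of $\mathcal{Q}(\mu_\ast,\Gamma_\ast,P)$ for the singular value $\sigma=\sigma_{-r}(\mathcal{Q}(\mu_\ast,\Gamma_\ast,P))$ (i.e. $\mathcal{Q}(\mu_\ast,\Gamma_\ast,P)V=\sigma U$ and $U^\ast\mathcal{Q}(\mu_\ast,\Gamma_\ast,P)=\sigma V^\ast$), and $\mathcal{V}\in\mathbb{C}^{n\times r}$ is defined by $V=\operatorname{vec}(\mathcal{V})$ (with $\operatorname{vec}$ stacking columns), then $\operatorname{rank}(\mathcal{V})=r$. *)

(* Defs.v *)
From HB Require Import structures.
From mathcomp Require Import all_boot all_order all_algebra.
From mathcomp Require Import complex.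
From mathcomp Require Import all_classical all_reals all_analysis.

Set Implicit Arguments.
Unset Strict Implicit.
Unset Printing Implicit Defensive.

Import Order.TTheory GRing.Theory Num.Theory.
Local Open Scope classical_set_scope.
Local Open Scope ring_scope.
Local Open Scope sesquilinear_scope.

Section MatrixNorms.
Context {R : realType}.
Local Notation C := R[i].

Definition l2norm {n} (x : 'cV[C]_n) : R :=
  Num.sqrt (\sum_i ComplexField.Normc.normc (x i 0) ^+ 2).

Definition opnorm2 {n} (A : 'M[C]_n) : R :=
  sup [set l2norm (A *m x) | x in [set x : 'cV[C]_n | l2norm x = 1]].

(* The matrix [A^t* *m A] is normal, so that its [spectral_diag] lists its
   (real, nonnegative) eigenvalues with multiplicity, in no specified order. *)
Definition singular_values {n} (A : 'M[C]_n) : seq R :=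
  sort <=%R
    [seq Num.sqrt (complex.Re (spectral_diag (A^t* *m A) 0 i)) | i : 'I_n].

(* [sigma_min k A] is the [k]th smallest singular value, for [1 <= k <= n]. *)
Definition sigma_min {n} (k : nat) (A : 'M[C]_n) : R :=
  nth 0 (singular_values A) k.-1.

End MatrixNorms.

Section MatrixPolynomials.
Context {R : realType}.
Local Notation C := R[i].

(* Matrix polynomials are represented as matrices of polynomials. *)
Definition mxpoly_of {m n} (A : 'I_m.+1 -> 'M[C]_n) : 'M[{poly C}]_n :=
  \sum_(j < m.+1) 'X^j *: map_mx polyC (A j).

Definition mxpoly_eval {n} (P : 'M[{poly C}]_n) (x : C) : 'M[C]_n :=
  map_mx (fun p => p.[x]) P.

Definition mxpoly_derivn {n} (k : nat) (P : 'M[{poly C}]_n) :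
    'M[{poly C}]_n :=
  map_mx (fun p => p^`(k)) P.

(* When the determinant is the zero polynomial, [mup] returns 0. *)
Definition alg_mult {n} (P : 'M[{poly C}]_n) (x : C) : nat :=
  mup x (\det P).

Definition tau {n} (P : 'M[{poly C}]_n) (S : seq C) (r : nat) : \bar R :=
  ereal_inf [set (opnorm2 D)%:E | D in
    [set D : 'M[C]_n |
      (r <= \sum_(x <- S) alg_mult (P + map_mx polyC D) x)%N]].

(* Divided difference at the nodes [x i, ..., x (i + k)], in which equal nodes
   are supposed to be contiguous. *)
Fixpoint divdiff_rec {n} (P : 'M[{poly C}]_n) (x : nat -> C) (k i : nat) :
    'M[C]_n :=
  if k is k'.+1 then
    if x i == x (i + k)%N then
      (k`!%:R)^-1 *: mxpoly_eval (mxpoly_derivn k P) (x i)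
    else
      (x (i + k)%N - x i)^-1 *:
        (divdiff_rec P x k' i.+1 - divdiff_rec P x k' i)
  else mxpoly_eval P (x i).

(* Reorders a sequence so that equal entries are contiguous; the sequence is
   left unchanged when they already are. *)
Definition contiguous (T : eqType) (s : seq T) : seq T :=
  flatten [seq nseq (count_mem x s) x | x <- undup s].

Definition divdiff {n} (P : 'M[{poly C}]_n) (s : seq C) : 'M[C]_n :=
  divdiff_rec P (nth 0 (contiguous s)) (size s).-1 0.

(* The parameters [(gamma_ik)_(k < i)] are the entries of a strictly lower
   triangular matrix. *)
Definition strictly_lower r : set 'M[C]_r :=
  [set G : 'M[C]_r | forall i k : 'I_r, (i <= k)%N -> G i k = 0].

(* A sequence [(s_0, ..., s_k)] is a [k.+1]-tuple; strictly increasing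
   sequences in ['I_r] have at most [r] terms, whence the bound on [k]. *)
Definition Qblock {n r} (mu : r.-tuple C) (G : 'M[C]_r)
    (P : 'M[{poly C}]_n) (i l : 'I_r) : 'M[C]_n :=
  if (l < i)%N then
    \sum_(k < r)
      \sum_(t : k.+1.-tuple 'I_r |
            [&& sorted (fun a b : 'I_r => (a < b)%N) t,
                head l t == l & last l t == i])
        (\prod_(j < k) G (nth l t j.+1) (nth l t j)) *:
          divdiff P [seq tnth mu a | a <- t]
  else if i == l then mxpoly_eval P (tnth mu i)
  else 0.

Definition Qmx {n r} (mu : r.-tuple C) (G : 'M[C]_r)
    (P : 'M[{poly C}]_n) : 'M[C]_(\sum_(i < r) n) :=
  \mxblock_(i < r, l < r) Qblock mu G P i l.

Definition vec {n r} (W : 'M[C]_(n, r)) : 'cV[C]_(\sum_(i < r) n) :=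
  \mxcol_(l < r) col l W.

Definition multiplicity_assumption {n r} (mu : r.-tuple C) (G : 'M[C]_r)
    (P : 'M[{poly C}]_n) : Prop :=
  count_mem (sigma_min r (Qmx mu G P)) (singular_values (Qmx mu G P)) = 1%N.

Definition independence_assumption {n r} (mu : r.-tuple C) (G : 'M[C]_r)
    (P : 'M[{poly C}]_n) : Prop :=
  let Q := Qmx mu G P in
  let sigma := (sigma_min r Q)%:C%C in
  forall (U V : 'cV[C]_(\sum_(i < r) n)) (W : 'M[C]_(n, r)),
    l2norm U = 1 -> l2norm V = 1 ->
    Q *m V = sigma *: U -> U^t* *m Q = sigma *: V^t* ->
    V = vec W -> \rank W = r.

Definition tuples_in (r : nat) (S : seq C) : set (r.-tuple C) :=
  [set mu : r.-tuple C | {subset mu <= S}].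

Definition sup_sigma {n r} (P : 'M[{poly C}]_n) (mu : r.-tuple C) : \bar R :=
  ereal_sup [set (sigma_min r (Qmx mu G P))%:E | G in @strictly_lower r].

Definition inf_sup_sigma {n} (r : nat) (P : 'M[{poly C}]_n) (S : seq C) :
    \bar R :=
  ereal_inf [set sup_sigma P mu | mu in @tuples_in r S].

End MatrixPolynomials.

Arguments strictly_lower {R} r _.
Arguments tuples_in {R} r S _.

(* Main.v *)
(** Let C be the lower triangular matrix with diagonal mu and strictly lower
    part Gamma. Descloux's formula for functions of triangular matrices says
    that Q(mu, Gamma, P) = P(C) = sum_j C^j (x) A_j. Hence Q is multiplicative
    in P, and conjugating C by S conjugates Q by S (x) I.

    Lower bound. If P + Delta has r eigenvalues mu_1, ..., mu_r in the set, one
    can split off r linear factors: P + Delta = P_1 B with B = B_r ... B_1 and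
    det B_i = X - mu_i. For distinct mu_i the matrix C is diagonalizable and
    B(C) visibly has nullity at least r; by semicontinuity of the rank this
    persists for arbitrary mu and every Gamma. So
    Q(mu, Gamma, P) + I (x) Delta has nullity at least r, and
    sigma_(-r)(Q(mu, Gamma, P)) <= |Delta|.

    Upper bound. Let U, V be the singular vectors at the optimum, and calU, calV
    the corresponding n x r matrices. Conjugating C by I + tE with E lower
    triangular only changes Gamma, hence does not increase the singular value.
    To first order in t this reads Re <U, (E (x) I) U> = Re <V, (E (x) I) V>,
    and letting E vary gives calU^* calU = calV^* calV. Therefore
    Delta = - sigma calU (calV^* calV)^-1 calV^* has norm at most sigma, and
    Q(mu, Gamma, P + Delta) V = 0. Since calV has rank r, this forces the
    characteristic polynomial of C to divide det (P + Delta). *)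

Require Import Defs.
From mathcomp Require Import all_boot all_order all_algebra.
From mathcomp Require Import complex.
From mathcomp Require Import all_classical all_reals all_analysis.
From mathcomp Require Import ring lra.

Set Implicit Arguments.
Unset Strict Implicit.
Unset Printing Implicit Defensive.

Import Order.TTheory GRing.Theory Num.Theory.
Local Open Scope ring_scope.

(** * The functional calculus P(C) *)

Section FunctionalCalculus.
Variables (K : comNzRingType) (n r : nat).
Implicit Types (C : 'M[K]_r.+1) (P : 'M[{poly K}]_n).

Definition kronmx (X : 'M[K]_r.+1) (A : 'M[K]_n) : 'M[K]_(\sum_(i < r.+1) n) :=
  \mxblock_(i < r.+1, l < r.+1) (X i l *: A).

(* Blockwise, this is [\sum_j C ^+ j (x) A_j] for [P = \sum_j 'X^j *: A_j]. *)
Definition mxpoly_at C P : 'M[K]_(\sum_(i < r.+1) n) :=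
  \mxblock_(i < r.+1, l < r.+1) \matrix_(a, b) (horner_mx C (P a b)) i l.

Lemma mul_kronmx X A Y B : kronmx X A *m kronmx Y B = kronmx (X *m Y) (A *m B).
Proof.
rewrite mul_mxblock; apply: eq_mxblock => i l.
rewrite mxE scaler_suml; apply: eq_bigr => j _.
by rewrite -scalemxAl -scalemxAr scalerA.
Qed.

Lemma kronmx1 : kronmx 1%:M 1%:M = 1%:M.
Proof.
rewrite -(mxdiagZ 1); apply: eq_mxblock => i l.
rewrite mxE; case: eqVneq => _; last by rewrite scale0r.
by rewrite conform_mx_id scale1r.
Qed.

Lemma kronmxDl X Y A : kronmx (X + Y) A = kronmx X A + kronmx Y A.
Proof. by rewrite -mxblockD; apply: eq_mxblock => i l; rewrite mxE scalerDl. Qed.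

Lemma kronmxZl a X A : kronmx (a *: X) A = a *: kronmx X A.
Proof. by apply/matrixP => i l; rewrite !mxE mulrA. Qed.

Lemma mxpoly_atD C P R : mxpoly_at C (P + R) = mxpoly_at C P + mxpoly_at C R.
Proof.
rewrite -mxblockD; apply: eq_mxblock => i l.
by apply/matrixP => a b; rewrite !mxE rmorphD mxE.
Qed.

Lemma mxpoly_atM C P R :
  mxpoly_at C (P *m R) = mxpoly_at C P *m mxpoly_at C R.
Proof.
rewrite mul_mxblock; apply: eq_mxblock => i l.
apply/matrixP => a b; rewrite !mxE summxE rmorph_sum summxE /=.
under [RHS]eq_bigr do rewrite mxE.
rewrite exchange_big /=; apply: eq_bigr => c _.
by rewrite rmorphM /= mxE; apply: eq_bigr => j _; rewrite !mxE.
Qed.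

Lemma mxpoly_atC C (D : 'M[K]_n) :
  mxpoly_at C (map_mx polyC D) = kronmx 1%:M D.
Proof.
apply: eq_mxblock => i l; apply/matrixP => a b.
by rewrite !mxE horner_mx_C !mxE mulrC mulr_natr.
Qed.

Lemma mxpoly_at_diag (d : 'rV[K]_r.+1) P :
  mxpoly_at (diag_mx d) P = \mxdiag_i map_mx (fun p => p.[d 0 i]) P.
Proof.
apply: eq_mxblock => i l; apply/matrixP => a b; rewrite mxE horner_mx_diag.
by rewrite !mxE; case: eqVneq => [->|_]; rewrite ?conform_mx_id !mxE.
Qed.

End FunctionalCalculus.

Lemma map_mxpoly_at (K L : comNzRingType) (f : {rmorphism K -> L}) n r
    (C : 'M[K]_r.+1) (P : 'M[{poly K}]_n) :
  map_mx f (mxpoly_at C P) = mxpoly_at (map_mx f C) (map_mx (map_poly f) P).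
Proof. by apply/matrixP => i l; rewrite !mxE -map_horner_mx mxE. Qed.

Section Similarity.
Variables (F : fieldType) (n r : nat).
Implicit Types (C S : 'M[F]_r.+1) (P : 'M[{poly F}]_n).

(** Each entry of [P] is evaluated at the matrix separately, so conjugation passes through
    [horner_mx] entrywise and acts on the block index only. *)
Lemma mxpoly_at_conj S C P : S \in unitmx ->
  mxpoly_at (S *m C *m invmx S) P =
  kronmx S 1%:M *m mxpoly_at C P *m kronmx (invmx S) 1%:M.
Proof.
move=> uS; rewrite !mul_mxblock; apply: eq_mxblock => i l.
apply/matrixP => a b; rewrite !mxE summxE horner_mx_uconj //.
rewrite mxE; apply: eq_bigr => j _.
rewrite scale_scalar_mx mulr1 mul_mx_scalar [RHS]mxE [RHS]mulrC; congr (_ * _).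
rewrite mxE summxE; apply: eq_bigr => k _.
by rewrite scale_scalar_mx mulr1 mul_scalar_mx !mxE.
Qed.

(** Up to similarity $P(C)$ is block diagonal with blocks $P(d_i)$; each of the [r.+1] blocks is
    singular and loses at least one rank. *)
Lemma rank_mxpoly_at_diagonalizable C P : diagonalizable C ->
  (forall x, eigenvalue C x -> \det (map_mx (fun p => p.[x]) P) = 0) ->
  (\rank (mxpoly_at C P) + r.+1 <= \sum_(i < r.+1) n)%N.
Proof.
case=> S uS /diagonalizable_forPex[d /(simmxRL uS) dE] singP.
have CE : C = invmx S *m diag_mx d *m S.
  by rewrite dE !mulmxA mulVmx // mul1mx mulmxKV.
have eigd i : eigenvalue C (d 0 i).
  apply/eigenvalueP; exists (row i S).
    rewrite -row_mul CE !mulmxA mulmxV // mul1mx row_mul row_diag_mx.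
    by rewrite -scalemxAl -rowE.
  (* The rows of [S] are the eigenvectors; a zero row would give [S] a nontrivial left kernel. *)
  apply: contraTneq uS => Si0; rewrite -row_free_unit -kermx_eq0.
  apply/negP => /eqP kerS; have: delta_mx 0 i *m kermx S = 0 :> 'rV_r.+1.
    by rewrite kerS mulmx0.
  have /sub_kermxP : delta_mx (0 : 'I_1) i *m S = 0 by rewrite -rowE.
  rewrite kerS submx0 => /eqP/matrixP/(_ 0 i); rewrite !mxE !eqxx => /eqP.
  by rewrite oner_eq0.
have -> : mxpoly_at C P = kronmx (invmx S) 1%:M *m mxpoly_at (diag_mx d) P
    *m kronmx S 1%:M.
  by rewrite CE -{2 4}(invmxK S) mxpoly_at_conj ?unitmx_inv.
apply: leq_trans (_ : \rank (mxpoly_at (diag_mx d) P) + r.+1 <= _)%N.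
  by rewrite leq_add2r (leq_trans (mxrankM_maxl _ _)) // mxrankM_maxr.
have sum1 : (r.+1 = \sum_(i < r.+1) 1)%N by rewrite sum1_card card_ord.
rewrite mxpoly_at_diag rank_mxdiag [X in (_ + X <= _)%N]sum1 -big_split /=.
apply: leq_sum => i _; rewrite addn1 ltn_neqAle rank_leq_row andbT.
rewrite [_ == _]row_free_unit unitmxE unitfE negbK.
by apply/eqP/singP/eigd.
Qed.

End Similarity.

(** * Splitting off linear factors *)

Section DetOuter.
Variables (K : comNzRingType) (n : nat).

(** The matrix determinant lemma: [B *m T] and [T *m B] are both block lower triangular, and their
    determinants agree. *)
Lemma det_1D_outer (u : 'rV[K]_n) (v : 'cV[K]_n) :
  \det (1%:M + v *m u) = 1 + (u *m v) 0 0.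
Proof.
pose B : 'M[K]_(1 + n) := block_mx 1%:M (- u) v 1%:M.
pose T : 'M[K]_(1 + n) := block_mx 1%:M u 0 1%:M.
have dT : \det T = 1 by rewrite det_ublock !det1 mulr1.
transitivity (\det (B *m T)).
  rewrite mulmx_block !mulmx1 !mulmx0 !mul1mx addr0 subrr addr0 det_lblock.
  by rewrite det1 mul1r addrC.
rewrite det_mulmx mulrC -det_mulmx mulmx_block !mulmx1 !mul1mx !mul0mx.
by rewrite !add0r addNr det_lblock det1 mulr1 det_mx11 !mxE eqxx.
Qed.

End DetOuter.

Section Factors.
Variable (F : numFieldType).

Lemma exists_nonroot (p : {poly F}) : p != 0 -> exists e, ~~ root p e.
Proof.
move=> p0; pose s : seq F := [seq i%:R | i <- iota 0 (size p)].
have us : uniq s.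
  by rewrite map_inj_uniq ?iota_uniq //; apply: (@mulrIn _ 1 _); rewrite oner_eq0.
case: (boolP (all (root p) s)) => [rs|/allPn[e _]]; last by exists e.
by have := max_poly_roots p0 rs us; rewrite size_map size_iota ltnn.
Qed.

Lemma map_polyC_horner_eval m n (A : 'M[F]_(m, n)) e :
  map_mx (horner_eval e) (map_mx polyC A) = A.
Proof. by apply/matrixP => i j; rewrite !mxE [LHS]hornerC. Qed.

(** Lower semicontinuity of the rank in algebraic form: a rank bound that holds off the roots of [q]
    extends to every point. *)
Lemma mxrank_specialize m n (M : 'M[{poly F}]_(m, n)) (q : {poly F}) k x :
    q != 0 ->
    (forall e, ~~ root q e -> \rank (map_mx (horner_eval e) M) <= k)%N ->
  (\rank (map_mx (horner_eval x) M) <= k)%N.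
Proof.
move=> q0 rkM; set M0 := map_mx _ _; set rk := \rank M0.
(* [L] and [R] compress [M0] to the identity of size [rk], so the compressed determinant is 1 at
   [x]. *)
pose L : 'M[F]_(rk, m) := pid_mx rk *m invmx (col_ebase M0).
pose R : 'M[F]_(n, rk) := invmx (row_ebase M0) *m pid_mx rk.
have LMR : L *m M0 *m R = 1%:M.
  rewrite -[M0 in X in X = _]mulmx_ebase /L /R !mulmxA mulmxKV ?col_ebase_unit //.
  rewrite mulmxK ?row_ebase_unit // !mul_pid_mx.
  rewrite minnn (minn_idPr (rank_leq_row M0)) minnn (minn_idPr (rank_leq_col M0)).
  apply/matrixP => i j; rewrite !mxE.
  by rewrite ltn_ord andbT.
(* A minor that is nonzero at [x] is nonzero at almost every [e]. *)
pose d := \det (map_mx polyC L *m M *m map_mx polyC R).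
have dE e : d.[e] = \det (L *m map_mx (horner_eval e) M *m R).
  rewrite -/(horner_eval e d) /d -det_map_mx !map_mxM /=.
  by rewrite !map_polyC_horner_eval.
have d0 : d != 0.
  apply/eqP => dz; have := dE x; rewrite -/M0 LMR det1 dz horner0 => /esym/eqP.
  by rewrite oner_eq0.
have [e] := exists_nonroot (mulf_neq0 d0 q0).
rewrite rootM negb_or => /andP[de qe]; apply: leq_trans (rkM e qe).
have : L *m map_mx (horner_eval e) M *m R \in unitmx.
  by rewrite unitmxE unitfE -dE.
rewrite -row_full_unit /row_full => /eqP <-.
by rewrite (leq_trans (mxrankM_maxl _ _)) // mxrankM_maxr.
Qed.

(* For an idempotent [E] of rank one, this is conjugate to the diagonal matrix
   with diagonal entries ['X - x, 1, ..., 1]. *)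
Definition peeled (K : comNzRingType) n (x : K) (E : 'M[K]_n) : 'M[{poly K}]_n :=
  1%:M + ('X - x%:P - 1) *: map_mx polyC E.

Lemma det_peeled (K : comNzRingType) n (x : K) (v : 'cV[K]_n) (u : 'rV[K]_n) :
  u *m v = 1%:M -> \det (peeled x (v *m u)) = 'X - x%:P.
Proof.
move=> uv; rewrite /peeled map_mxM scalemxAl det_1D_outer -scalemxAr -map_mxM uv.
by rewrite !mxE eqxx mulr1 addrC subrK.
Qed.

(** For a null vector [v] of $P(x)$, the column $Pv$ is divisible by $X - x$. Replacing $P$ by this
    quotient along [v], and leaving it unchanged on the kernel of [u], removes one linear factor on
    the right. *)
Lemma peel n (P : 'M[{poly F}]_n) x : root (\det P) x ->
  exists (v : 'cV[F]_n) (u : 'rV[F]_n) (P1 : 'M[{poly F}]_n),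
    [/\ u *m v = 1%:M, P = P1 *m peeled x (v *m u)
                    & \det P = \det P1 * ('X - x%:P)].
Proof.
move=> /rootP Px.
have : \det (map_mx (horner_eval x) P)^T = 0 by rewrite det_tr det_map_mx.
move=> /eqP/det0P[w w0 /(congr1 trmx)]; rewrite trmx_mul trmxK trmx0.
set v := w^T => Pv.
have [i vi] : exists i, v i 0 != 0.
  apply/existsP; apply: contraNT w0 => /existsPn wz; apply/eqP/rowP => i.
  by have /negPn/eqP := wz i; rewrite !mxE.
pose u := (v i 0)^-1 *: delta_mx 0 i : 'rV_n.
have uv : u *m v = 1%:M.
  rewrite -scalemxAl -rowE; apply/matrixP => a b.
  by rewrite [LHS]mxE [row _ _ _ _]mxE !ord1 mulVf // mxE eqxx.
pose Pv' := P *m map_mx polyC v.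
pose q := map_mx (fun p => p %/ ('X - x%:P)) Pv'.
have qE : Pv' = ('X - x%:P) *: q.
  apply/matrixP => a b; rewrite !mxE mulrC divpK // dvdp_XsubCl.
  have /matrixP/(_ a b) := Pv; rewrite !mxE => s0; rewrite /root -s0.
  rewrite horner_sum; apply/eqP/eq_bigr => j _.
  by rewrite !mxE hornerM hornerC horner_evalE.
pose P1 := P - Pv' *m map_mx polyC u + q *m map_mx polyC u.
have PE : P = P1 *m peeled x (v *m u).
  have uv' : map_mx polyC u *m map_mx polyC v = 1%:M by rewrite -map_mxM uv map_mx1.
  rewrite /P1 /peeled map_mxM mulmxDr mulmx1 -scalemxAr mulmxA.
  rewrite (mulmxDl _ _ (map_mx _ v)) mulmxBl -!(mulmxA _ (map_mx polyC u)) uv' !mulmx1.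
  rewrite subrr add0r scalemxAl scalerBl -qE scale1r mulmxBl.
  by rewrite addrA addrAC addrK subrK.
exists v, u, P1; split => //.
by rewrite {1}PE det_mulmx det_peeled.
Qed.

Lemma sum_mup_mulXsubC (S : seq F) x (p : {poly F}) : uniq S -> x \in S ->
  p != 0 ->
  (\sum_(y <- S) mup y (p * ('X - x%:P)) = (\sum_(y <- S) mup y p).+1)%N.
Proof.
move=> uS xS p0.
have <- : (\sum_(y <- S) mup y p + count_mem x S)%N = (\sum_(y <- S) mup y p).+1.
  by rewrite count_uniq_mem // xS addn1.
rewrite -sum1_count (big_mkcond (pred1 x)) -big_split /=; apply: eq_bigr => y _.
rewrite mupM ?polyXsubC_eq0 // -['X - _]expr1 mup_XsubCX eq_sym.
by case: (y == x).
Qed.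

(** The determinant of each factor is given for every node [x], not only for [p.1], because the
    nodes are perturbed later while the idempotents stay fixed. *)
Lemma peel_seq n (S : seq F) r (P : 'M[{poly F}]_n) : uniq S ->
    (r <= \sum_(x <- S) mup x (\det P))%N ->
  exists (l : seq (F * 'M[F]_n)) (P1 : 'M[{poly F}]_n),
    [/\ size l = r, {subset map fst l <= S},
        (forall p x, p \in l -> \det (peeled x p.2) = 'X - x%:P)
      & P = P1 *m \prod_(p <- l) peeled p.1 p.2].
Proof.
move=> uS; elim: r P => [|r IHr] P.
  by exists [::], P; split => //; rewrite big_nil mulmx1.
move=> ler.
have d0 : \det P != 0.
  (* [mup] is 0 on the zero polynomial, so a positive count forces a nonzero determinant. *)
  apply: contraTneq ler => ->; rewrite big1 ?ltn0 // => x _.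
  rewrite /mup; case: arg_maxnP => [|i _ _]; rewrite ?dvdp0 //.
  by move: i; rewrite size_poly0 => -[[]].
have [x xS rx] : exists2 x, x \in S & root (\det P) x.
  apply/hasP; apply: contraTT ler => /hasPn nr; rewrite big1_seq // => x /andP[_ /nr].
  exact: mupNroot.
have [v [u [P1 [uv PE dP]]]] := peel rx.
have d1 : \det P1 != 0 by apply: contraNneq d0 => d1; rewrite dP d1 mul0r.
have [|l [P2 [sl lS dl P1E]]] := IHr P1.
  by rewrite -ltnS -(sum_mup_mulXsubC uS xS) // -dP.
exists (rcons l (x, v *m u)), P2; split.
- by rewrite size_rcons sl.
- by move=> y; rewrite map_rcons mem_rcons inE => /predU1P[->|/lS].
- by move=> p y; rewrite mem_rcons inE => /predU1P[->|/dl //]; rewrite det_peeled.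
- by rewrite -cats1 big_cat big_seq1 /= mulmxA -P1E.
Qed.

Lemma diagonalizable_trig r (C : 'M[F]_r.+1) : is_trig_mx C ->
  injective (fun i => C i i) -> diagonalizable C.
Proof.
move=> tC injC; apply/diagonalizableP.
exists [seq C i i | i <- enum 'I_r.+1].
  by rewrite map_inj_uniq // enum_uniq.
rewrite big_map big_enum /=; rewrite -char_poly_trig //; exact: mxminpoly_dvd_char.
Qed.

(** Distinct diagonal entries make [C] diagonalizable, and the determinant of the product, $\prod_i
    (X - C_{ii})$, vanishes at each eigenvalue of [C]. *)
Lemma rank_mxpoly_at_peeled_inj n r (C : 'M[F]_r.+1) (E : 'I_r.+1 -> 'M[F]_n) :
    is_trig_mx C -> injective (fun i => C i i) ->
    (forall i x, \det (peeled x (E i)) = 'X - x%:P) ->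
  (\rank (mxpoly_at C (\prod_i peeled (C i i) (E i))) + r.+1 <=
    \sum_(i < r.+1) n)%N.
Proof.
move=> tC injC dE; apply: rank_mxpoly_at_diagonalizable.
  exact: diagonalizable_trig.
move=> x; rewrite eigenvalue_root_char char_poly_trig // => rx.
have -> : map_mx (fun p => p.[x]) (\prod_i peeled (C i i) (E i)) =
   map_mx (horner_eval x) (\prod_i peeled (C i i) (E i)) by [].
rewrite det_map_mx (big_morph _ (@det_mulmx _ _) (det1 _ _)) /=.
under eq_bigr do rewrite dE.
exact/rootP.
Qed.

Lemma map_peeled (K L : comNzRingType) (f : {rmorphism K -> L}) n x (E : 'M[K]_n) :
  map_mx (map_poly f) (peeled x E) = peeled (f x) (map_mx f E).
Proof.
apply/matrixP => i j; rewrite !mxE rmorphD rmorphM !rmorphB /= rmorph_nat.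
by rewrite map_polyX !map_polyC /= rmorph1.
Qed.

(** Nodes of [C] and of the factors are moved together until distinct, and the rank bound is
    specialized back at parameter 0. *)
Lemma rank_mxpoly_at_peeled n r (C : 'M[F]_r.+1) (E : 'I_r.+1 -> 'M[F]_n) :
    (0 < n)%N ->
    is_trig_mx C -> (forall i x, \det (peeled x (E i)) = 'X - x%:P) ->
  (\rank (mxpoly_at C (\prod_i peeled (C i i) (E i))) + r.+1 <=
    \sum_(i < r.+1) n)%N.
Proof.
move=> n_gt0 tC dE.
(* The diagonal entries are separated by the perturbation [C i i + i * 'X]. *)
pose xe (i : 'I_r.+1) : {poly F} := (C i i)%:P + (i%:R)%:P * 'X.
pose Ce := map_mx polyC C + diag_mx (\row_i ((i%:R)%:P * 'X)) : 'M[{poly F}]_r.+1.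
pose B (K : comNzRingType) (x : 'I_r.+1 -> K) (G : 'I_r.+1 -> 'M[K]_n) :=
  \prod_i peeled (x i) (G i).
pose M := mxpoly_at Ce (B _ xe (fun i => map_mx polyC (E i))).
(* The roots of [q] are the parameters at which two perturbed nodes collide; [q] is nonzero because
   the slopes [i%:R] differ in characteristic zero. *)
pose q := \prod_i \prod_(j | j != i) (xe i - xe j).
have q0 : q != 0.
  apply/prodf_neq0 => i _; apply/prodf_neq0 => j ji.
  apply/eqP => /(congr1 (coefp 1)); rewrite /= !(coefB, coefD, coefC, coefCM, coefX) /=.
  rewrite !mulr1 !add0r => /eqP; rewrite subr_eq0 eqr_nat => /eqP ij.
  by case/eqP: ji; apply/val_inj.
have CeE e : map_mx (horner_eval e) Ce = C + diag_mx (\row_i (i%:R * e)).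
  rewrite map_mxD map_polyC_horner_eval; congr (_ + _).
  apply/matrixP => i j; rewrite !mxE.
  by rewrite /= horner_evalE hornerMn hornerM hornerC hornerX.
have ME e : map_mx (horner_eval e) M =
    mxpoly_at (map_mx (horner_eval e) Ce) (B _ (fun i => (xe i).[e]) E).
  rewrite map_mxpoly_at; congr mxpoly_at.
  rewrite /B rmorph_prod.
  by apply: eq_bigr => i _; rewrite /= map_peeled map_polyC_horner_eval.
have xeE e i : (xe i).[e] = map_mx (horner_eval e) Ce i i.
  by rewrite CeE !mxE eqxx /xe hornerD hornerM !hornerC hornerX.
have rkM : (\rank (map_mx (horner_eval 0) M) <= \sum_(i < r.+1) n - r.+1)%N.
  refine (@mxrank_specialize _ _ M q _ 0 q0 _) => e qe.
  rewrite -(leq_add2r r.+1) subnK; last first.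
    by rewrite sum_nat_const card_ord leq_pmulr.
  rewrite ME /B; under eq_bigr do rewrite xeE.
  apply: rank_mxpoly_at_peeled_inj => //.
    rewrite CeE; apply/is_trig_mxP => i j ij.
    by rewrite !mxE (is_trig_mxP tC) // -val_eqE ltn_eqF // addr0.
  move=> i j /eqP; rewrite -!xeE; apply: contraTeq => ij.
  apply: contra qe => /eqP xij; rewrite /q (bigD1 i) //= (bigD1 j) 1?eq_sym //=.
  by rewrite rootE !hornerM hornerD hornerN xij subrr !mul0r.
have M0 : map_mx (horner_eval 0) M = mxpoly_at C (B _ (fun i => C i i) E).
  rewrite ME CeE; have -> : C + diag_mx (\row_i (i%:R * 0)) = C.
    apply/matrixP => i j; rewrite !mxE mulr0.
    by rewrite mul0rn addr0.
  congr mxpoly_at; apply: eq_bigr => i _.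
  by rewrite xeE CeE !mxE mulr0 mul0rn addr0.
move: rkM; rewrite M0 -(leq_add2r r.+1) subnK //.
by rewrite sum_nat_const card_ord leq_pmulr.
Qed.

End Factors.

(** * Kernels and multiplicities *)

(** The nodes are read off the linear factors of [P] alone, so one [mu] serves all triangular [C]
    with that diagonal. *)
Lemma exists_rank_mxpoly_at (F : numFieldType) n r (S : seq F)
    (P : 'M[{poly F}]_n) : (0 < n)%N -> uniq S ->
    (r.+1 <= \sum_(x <- S) mup x (\det P))%N ->
  exists2 mu : r.+1.-tuple F, {subset mu <= S} &
    forall C : 'M[F]_r.+1, is_trig_mx C -> (forall i, C i i = tnth mu i) ->
      (\rank (mxpoly_at C P) + r.+1 <= \sum_(i < r.+1) n)%N.
Proof.
move=> n_gt0 uS /(peel_seq uS)[l [P1 [sl lS dl PE]]].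
have sl' : size (map fst l) == r.+1 by rewrite size_map sl.
exists (Tuple sl') => // C tC Cd.
have CdE i : C i i = (nth (0, 0) l i).1.
  by rewrite Cd (tnth_nth 0) /= (nth_map (0, 0)) ?sl.
rewrite PE mxpoly_atM (leq_trans (leq_add (mxrankM_maxr _ _) (leqnn _))) //.
rewrite (big_nth (0, 0)) sl big_mkord.
rewrite (eq_bigr (fun i => peeled (C i i) (nth (0, 0) l i).2)); last first.
  by move=> i _; rewrite CdE.
by apply: rank_mxpoly_at_peeled => // i x; rewrite dl // mem_nth ?sl.
Qed.

Lemma leq_sum_mup (F : numFieldType) (S s : seq F) (p : {poly F}) : uniq S ->
    {subset s <= S} -> p != 0 -> \prod_(x <- s) ('X - x%:P) %| p ->
  (size s <= \sum_(x <- S) mup x p)%N.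
Proof.
move=> uS; elim: s p => [|x s IHs] // p sS p0.
rewrite big_cons => /dvdpP[q pE].
have {}pE : p = q * \prod_(y <- s) ('X - y%:P) * ('X - x%:P).
  by rewrite pE -mulrA [_ * \prod_(_ <- _) _]mulrC.
move: p0; rewrite pE mulf_eq0 negb_or => /andP[p0 _].
rewrite sum_mup_mulXsubC ?sS ?mem_head // ltnS; apply: IHs => //.
  by move=> y ys; apply/sS/mem_behead.
exact: dvdp_mull.
Qed.

Section InvariantPair.
Variable (F : fieldType).

(** The matrix remainder theorem: $XI - C$ divides $p(X)I - p(C)$ on the left. The induction follows
    Horner's scheme. *)
Lemma horner_mx_factor r (C : 'M[F]_r.+1) (p : {poly F}) :
  exists G, p%:M = map_mx polyC (horner_mx C p) + char_poly_mx C *m G.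
Proof.
elim/poly_ind: p => [|p c [G IH]].
  by exists 0; rewrite mulmx0 addr0 !raddf0.
set A := map_mx _ _ in IH; pose C' := map_mx polyC C.
exists (A + 'X *: G).
have AC : map_mx polyC (horner_mx C (p * 'X + c%:P)) = C' *m A + (c%:P)%:M.
  rewrite rmorphD rmorphM /= horner_mx_X horner_mx_C map_mxD map_scalar_mx.
  by rewrite -[_ * C]/(_ *m C) -comm_mx_horner // map_mxM.
have XA : char_poly_mx C *m A = 'X *: A - C' *m A.
  by rewrite mulmxBl mul_scalar_mx.
have -> : (p * 'X + c%:P)%:M = 'X *: p%:M + (c%:P)%:M :> 'M[{poly F}]_r.+1.
  by rewrite raddfD /= mulrC scale_scalar_mx.
rewrite AC mulmxDr XA -scalemxAr IH scalerDr [RHS]addrACA.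
by rewrite [C' *m A + _]addrC subrK -addrA; congr (_ + _); rewrite addrC.
Qed.

(** The remainder theorem turns $P(C)\operatorname{vec}(W) = 0$ into $W^T P^T = (XI - C)K$.
    Completing the independent rows of $W^T$ to an invertible matrix and taking determinants gives
    the divisibility. *)
Lemma dvdp_char_poly_det n r (C : 'M[F]_r.+1) (P : 'M[{poly F}]_n)
    (W : 'M[F]_(n, r.+1)) : \rank W = r.+1 ->
    mxpoly_at C P *m \mxcol_l col l W = 0 ->
  char_poly C %| \det P.
Proof.
move=> rW PW0.
(* The same null condition, regrouped by the row index [a] of [P] instead of by blocks. *)
have PW a : \sum_b horner_mx C (P a b) *m (row b W)^T = 0.
  apply/matrixP => i j; rewrite ord1 summxE mxE.
  have := congr1 (fun M => submxcol M i a 0) PW0.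
  rewrite mul_mxblock_mxrow mxcolK submxcol0 [in X in _ = X]mxE summxE.
  apply: etrans; transitivity (\sum_b \sum_l horner_mx C (P a b) i l * W b l).
    by apply: eq_bigr => b _; rewrite mxE; apply: eq_bigr => l _; rewrite !mxE.
  rewrite exchange_big; apply: eq_bigr => l _ /=; rewrite mxE.
  by apply: eq_bigr => b _; rewrite !mxE.
have [G GE] := fin_all_exists (fun a =>
  fin_all_exists (fun b => horner_mx_factor C (P a b))).
pose K : 'M[{poly F}]_(r.+1, n) :=
  \matrix_(i, a) (\sum_b G a b *m map_mx polyC (row b W)^T) i 0.
have WPK : map_mx polyC W^T *m P^T = char_poly_mx C *m K.
  apply/matrixP => i a.
  transitivity ((\sum_b (P a b)%:M *m map_mx polyC (row b W)^T) i 0).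
    rewrite mxE summxE; apply: eq_bigr => b _.
    by rewrite mul_scalar_mx !mxE mulrC.
  transitivity ((char_poly_mx C *m \sum_b G a b *m map_mx polyC (row b W)^T) i 0); last first.
    rewrite !mxE; apply: eq_bigr => l _; congr (_ * _).
    by rewrite [RHS]mxE.
  under eq_bigr do rewrite GE mulmxDl -map_mxM -mulmxA.
  rewrite big_split /= -mulmx_sumr.
  rewrite -[\sum_(i < n) map_mx _ _](raddf_sum (map_mx polyC)) PW raddf0.
  by rewrite add0r.
have [q nE] : exists q, n = (r.+1 + q)%N.
  by exists (n - r.+1)%N; rewrite subnKC // -rW rank_leq_row.
move: rW K WPK; clear PW PW0 G GE; subst n => rW K WPK.
(* The first [r.+1] rows of [E] span the row space of [W^T]; the remaining rows [Z] complete [W^T]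
   to a basis. *)
pose E := row_ebase W^T; pose Z := dsubmx E.
have WE : W^T = col_ebase W^T *m usubmx E.
  rewrite -[LHS]mulmx_ebase mxrank_tr rW pid_mx_row -mulmxA; congr (_ *m _).
  by rewrite -/E -[E in LHS]vsubmxK mul_row_col mul1mx mul0mx addr0.
have uFull : col_mx W^T Z \in unitmx.
  have -> : col_mx W^T Z = block_mx (col_ebase W^T) 0 0 1%:M *m E.
    rewrite -[E in RHS]vsubmxK mul_block_col !mul0mx addr0 add0r mul1mx.
    by rewrite -WE.
  rewrite unitmx_mul row_ebase_unit andbT unitmxE det_ublock det1 mulr1 -unitmxE.
  exact: col_ebase_unit.
have detE : (\det (col_mx W^T Z))%:P * \det P =
    char_poly C * \det (col_mx K (map_mx polyC Z *m P^T)).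
  rewrite -det_map_mx -[\det P]det_tr -det_mulmx map_col_mx mul_col_mx WPK.
  have -> : char_poly C = \det (block_mx (char_poly_mx C) 0 0 (1%:M : 'M[{poly F}]_q)).
    by rewrite det_ublock det1 mulr1.
  by rewrite -det_mulmx mul_block_col !mul0mx addr0 add0r mul1mx.
have c0 : \det (col_mx W^T Z) != 0 by rewrite -unitfE -unitmxE.
by rewrite -(dvdpZr _ _ c0) -mul_polyC detE dvdp_mulr.
Qed.

End InvariantPair.

(** * Divided differences *)

Section DividedDifferences.
Variable F : fieldType.
Implicit Types (f g : {poly F}) (s : seq F).

(* The divided difference as the leading coefficient of the interpolation
   polynomial: in this form it is visibly symmetric in the nodes. *)
Definition ddiff f s := (f %% \prod_(x <- s) ('X - x%:P))`_(size s).-1.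

Lemma ddiff_perm f s t : perm_eq s t -> ddiff f s = ddiff f t.
Proof. by move=> st; rewrite /ddiff (perm_big _ st) (perm_size st). Qed.

Lemma ddiffD f g s : ddiff (f + g) s = ddiff f s + ddiff g s.
Proof. by rewrite /ddiff modpD coefD. Qed.

Lemma ddiffZ c f s : ddiff (c *: f) s = c * ddiff f s.
Proof. by rewrite /ddiff modpZl coefZ. Qed.

Lemma ddiff1 f x : ddiff f [:: x] = f.[x].
Proof. by rewrite /ddiff big_seq1 modp_XsubC coefC. Qed.

(** Newton's interpolation step: a new node adds a multiple of the nodal polynomial of the old
    ones. *)
Lemma modp_prod_XsubC_cons f x s :
  f %% \prod_(y <- x :: s) ('X - y%:P) =
  ddiff f (x :: s) *: \prod_(y <- s) ('X - y%:P) + f %% \prod_(y <- s) ('X - y%:P).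
Proof.
set w := \prod_(y <- s) _; have sw : size w = (size s).+1 by rewrite size_prod_XsubC.
have mw : w \is monic by exact: monic_prod_XsubC.
have w0 : w != 0 by rewrite monic_neq0.
set r := f %% _; set c := ddiff _ _.
have sr : (size r <= size w)%N.
  rewrite -ltnS sw -[X in (_ < X)%N](size_prod_XsubC (x :: s) id) ltn_modpN0 //.
  by rewrite monic_neq0 // monic_prod_XsubC.
have src : (size (r - c *: w)%R < size w)%N.
  rewrite [X in (_ < X)%N]sw ltnS; apply/leq_sizeP => j.
  rewrite leq_eqVlt => /predU1P[<-|ltj].
    rewrite coefB coefZ.
    have -> : w`_(size s) = 1 by move/monicP: mw; rewrite lead_coefE sw.
    by rewrite mulr1 /c /ddiff /= -/r subrr.
  rewrite coefB coefZ ![_`_j]nth_default ?mulr0 ?subr0 //.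
    by rewrite sw.
  by rewrite (leq_trans sr) // sw.
have <- : r - c *: w = f %% w.
  rewrite -[LHS](modp_small src) modpD modNp modpZl modpp scaler0 subr0.
  rewrite [in RHS](divp_eq f (\prod_(y <- x :: s) ('X - y%:P))) -/r modpD.
  by rewrite big_cons -/w mulrA modp_mull add0r.
by rewrite addrC subrK.
Qed.

(** The Leibniz rule for multiplication by $X$. In Newton's form the top term $c\,w X$ is $c\,w (X -
    x) + c x\,w$, whose first summand vanishes modulo the nodal polynomial. *)
Lemma ddiff_mulX f x s : s != [::] ->
  ddiff (f * 'X) (x :: s) = x * ddiff f (x :: s) + ddiff f s.
Proof.
case: s => // y s _; set t := y :: s.
set w := \prod_(z <- t) ('X - z%:P).
have sw : size w = (size s).+2 by rewrite size_prod_XsubC.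
have mw : w \is monic by exact: monic_prod_XsubC.
have w0 : w != 0 by rewrite monic_neq0.
set c := ddiff f (x :: t).
have sfw : (size (f %% w)%R < size w)%N by rewrite ltn_modpN0.
have -> : ddiff (f * 'X) (x :: t) = ((c * x) *: w + (f %% w) * 'X)`_(size s).+1.
  rewrite /ddiff /=; congr (_`_ _).
  have fE : f * 'X = ((f %/ \prod_(z <- x :: t) ('X - z%:P)) * 'X + c%:P) *
      \prod_(z <- x :: t) ('X - z%:P) + ((c * x) *: w + (f %% w) * 'X).
    rewrite {1}(divp_eq f (\prod_(z <- x :: t) ('X - z%:P))) modp_prod_XsubC_cons.
    rewrite -/c -/w big_cons -/w -!mul_polyC polyCM.
    ring.
  rewrite fE modp_addl_mul_small // size_prod_XsubC /=.
  rewrite (leq_ltn_trans (size_polyD _ _)) // gtn_max; apply/andP; split.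
    by rewrite (leq_ltn_trans (size_scale_leq _ _)) // sw.
  have [->|n0] := eqVneq (f %% w) 0; first by rewrite mul0r size_poly0.
  by rewrite size_mulX // ltnS -sw.
rewrite coefD coefZ coefMX /=.
have -> : w`_(size s).+1 = 1 by move/monicP: mw; rewrite lead_coefE sw.
by rewrite mulr1 mulrC.
Qed.

Lemma ddiffC c x s : s != [::] -> ddiff c%:P (x :: s) = 0.
Proof.
case: s => // y s _; rewrite /ddiff modp_small ?size_prod_XsubC.
  by rewrite coefC.
by rewrite size_polyC; case: (c != 0).
Qed.

(** By symmetry in the nodes, the divided difference of $Xf$ can be expanded by the Leibniz rule at
    [x] or at [y]; the recursion is the equality of the two expansions. *)
Lemma ddiff_rec f x y s :
  (y - x) * ddiff f (x :: rcons s y) = ddiff f (rcons s y) - ddiff f (x :: s).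
Proof.
have e1 := ddiff_mulX f x (s := rcons s y).
have e2 := ddiff_mulX f y (s := x :: s) isT.
have p : perm_eq (y :: x :: s) (x :: rcons s y).
  by rewrite -rcons_cons perm_sym perm_rcons.
rewrite !(ddiff_perm _ p) in e2; rewrite e1 in e2; last by case: (s).
rewrite mulrBl; move/eqP: e2; rewrite -subr_eq => /eqP <-.
ring.
Qed.

(** Writing $f = (X - x)g + f(x)$ removes one node from the divided difference, while $f^{(k+1)}(x)
    = (k+1)\,g^{(k)}(x)$. *)
Lemma ddiff_nseq (f : {poly F}) x k : (k`!%:R : F) != 0 ->
  ddiff f (nseq k.+1 x) = (k`!%:R)^-1 * f^`(k).[x].
Proof.
elim: k f => [|k IHk] f; first by rewrite ddiff1 fact0 invr1 mul1r derivn0.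
rewrite factS natrM mulf_eq0 negb_or => /andP[k0 fk0].
set g := f %/ ('X - x%:P).
have fE : f = g * 'X + (f.[x])%:P - x *: g.
  by rewrite {1}(divp_eq f ('X - x%:P)) modp_XsubC -/g -mul_polyC; ring.
have -> : ddiff f (nseq k.+2 x) = ddiff g (nseq k.+1 x).
  rewrite {1}fE -scaleNr !ddiffD ddiffC // ddiffZ ddiff_mulX //.
  by rewrite addr0 mulNr addrAC subrr add0r.
rewrite IHk // [in RHS]fE derivnB derivnMXaddC derivnZ !hornerE hornerMn.
rewrite -[_.[x] *+ _]mulr_natl [_ * x]mulrC addrK.
move: (g^`(k).[x]) (k.+1%:R) (k`!%:R) k0 fk0 => G u v u0 v0.
by field; rewrite u0 v0.
Qed.

End DividedDifferences.

Lemma contiguous_sorted (T : eqType) (s : seq T) :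
  sorted (fun x y => index x (undup s) <= index y (undup s))%N (contiguous s).
Proof.
set R : rel T := fun x y => (index x (undup s) <= index y (undup s))%N.
have trR : transitive R by move=> y x z; exact: leq_trans.
rewrite sorted_pairwise // /contiguous.
have : pairwise R (undup s).
  case: s @R trR => // x s R trR; apply/(pairwiseP x) => i j si sj ij.
  by rewrite /R !index_uniq ?undup_uniq // ltnW.
elim: (undup s) => //= x u IHu /andP[xu pu].
rewrite pairwise_cat IHu // andbT; apply/andP; split.
  apply/allrelP => y z; rewrite mem_nseq => /andP[_ /eqP->].
  move=> /flatten_mapP[w wu]; rewrite mem_nseq => /andP[_ /eqP->].
  exact: (allP xu).
elim: (count_mem x s) => //= k IHk; rewrite IHk andbT.
by apply/allP => y; rewrite mem_nseq => /andP[_ /eqP->]; rewrite /R.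
Qed.

(** Entries are ordered by their index in [undup s], so equal endpoints squeeze everything between
    them. Hence the derivative branch of [divdiff_rec] is only reached when all its nodes
    coincide. *)
Lemma contiguous_nth (T : eqType) (x0 : T) (s : seq T) i j k :
    (i <= j <= k)%N -> (k < size (contiguous s))%N ->
    nth x0 (contiguous s) i = nth x0 (contiguous s) k ->
  nth x0 (contiguous s) j = nth x0 (contiguous s) i.
Proof.
move=> /andP[ij jk] ks eq_ik; set t := contiguous s in ks eq_ik *.
have trR : transitive (fun x y => index x (undup s) <= index y (undup s))%N.
  by move=> y x z; exact: leq_trans.
have mono := sorted_leq_nth trR (fun x => leqnn _) x0 (contiguous_sorted s).
have js := leq_ltn_trans jk ks; have iS := leq_ltn_trans ij js.
have ts x : x \in t -> x \in undup s.
  by rewrite mem_undup (perm_mem (perm_count_undup s)).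
have := mono j k js ks jk; have := mono i j iS js ij.
rewrite -/t -eq_ik => h1 h2.
have /(congr1 (nth x0 (undup s))) :
  index (nth x0 t j) (undup s) = index (nth x0 t i) (undup s).
  by apply/eqP; rewrite eqn_leq h1 h2.
by rewrite !nth_index // ts // mem_nth.
Qed.

Section DividedDifference.
Variable R : realType.
Local Notation C := R[i].

Lemma divdiff_recE n (P : 'M[{poly C}]_n) (s : seq C) k i a b :
    (i + k < size (contiguous s))%N ->
  divdiff_rec P (nth 0 (contiguous s)) k i a b =
  ddiff (P a b) (take k.+1 (drop i (contiguous s))).
Proof.
set t := contiguous s; elim: k i => [|k IHk] i iks.
  rewrite addn0 in iks.
  by rewrite (drop_nth 0) //= take0 ddiff1 mxE.
have it : (i < size t)%N by apply: leq_ltn_trans iks; rewrite leq_addr.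
have i1t : (i.+1 + k < size t)%N by rewrite addSnnS.
have ik : (i + k < size t)%N by apply: leq_ltn_trans i1t; rewrite addSn leqnSn.
have tk : take k.+1 (drop i.+1 t) = rcons (take k (drop i.+1 t)) (nth 0 t (i + k.+1)).
  by rewrite (take_nth 0) ?nth_drop ?addSnnS // size_drop ltn_subRL addnC -addSnnS addnC.
rewrite /=; case: eqP => [eq_ik|/eqP neq_ik].
  have -> : take k.+2 (drop i t) = nseq k.+2 (nth 0 t i).
    have sz : size (take k.+2 (drop i t)) = k.+2.
      by rewrite size_takel // size_drop ltn_subRL.
    apply: (@eq_from_nth _ 0) => [|j]; rewrite sz ?size_nseq // => jk.
    rewrite nth_take // nth_drop nth_nseq jk.
    by apply: contiguous_nth eq_ik; rewrite // leq_addr leq_add2l.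
  rewrite ddiff_nseq ?pnatr_eq0 -?lt0n ?fact_gt0 //.
  by rewrite !mxE.
rewrite !mxE !IHk //.
have -> : take k.+1 (drop i t) = nth 0 t i :: take k (drop i.+1 t).
  by rewrite (drop_nth 0).
have -> : take k.+2 (drop i t) = nth 0 t i :: take k.+1 (drop i.+1 t).
  by rewrite (drop_nth 0).
rewrite tk -ddiff_rec mulrA mulVf ?mul1r //.
by rewrite subr_eq0 eq_sym.
Qed.

Lemma divdiffE n (P : 'M[{poly C}]_n) (s : seq C) a b : s != [::] ->
  divdiff P s a b = ddiff (P a b) s.
Proof.
move=> s0; have ps : perm_eq (contiguous s) s by exact: perm_count_undup.
rewrite -size_eq0 -lt0n in s0.
rewrite /divdiff divdiff_recE; last by rewrite add0n (perm_size ps) prednK.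
by rewrite prednK // drop0 -(perm_size ps) take_size; apply: ddiff_perm.
Qed.

End DividedDifference.

(** * Descloux's formula *)

Section PathSums.
Variables (F : fieldType) (r : nat) (G : 'M[F]_r.+1) (mu : 'I_r.+1 -> F).
Hypothesis lowG : forall i k : 'I_r.+1, (i <= k)%N -> G i k = 0.

Fixpoint path_weight (l : 'I_r.+1) (s : seq 'I_r.+1) : F :=
  if s is a :: s' then G a l * path_weight a s' else 1.

(* Monotonicity of [l :: t] is not required: [path_weight] vanishes otherwise. *)
Definition path_sum k (f : {poly F}) (i l : 'I_r.+1) : F :=
  \sum_(t : k.-tuple 'I_r.+1 | last l t == i)
    path_weight l t * ddiff f (map mu (l :: t)).

Lemma path_weight_neq0 l s : path_weight l s != 0 ->
  path (fun a b : 'I_r.+1 => a < b)%N l s.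
Proof.
elim: s l => //= a s IHs l; rewrite mulf_eq0 negb_or => /andP[Gal /IHs->].
by rewrite andbT ltnNge; apply: contra Gal => /lowG->.
Qed.

(** A nonzero weight would make [l :: s] a strictly increasing sequence of more than [r.+1]
    indices. *)
Lemma path_weight_size l s : (r < size s)%N -> path_weight l s = 0.
Proof.
move=> rs; apply: contraTeq rs => /path_weight_neq0 ps; rewrite -leqNgt -ltnS.
have : uniq (l :: s).
  by apply: (sorted_uniq (leT := fun a b : 'I_r.+1 => a < b)%N) => // [b a c|a];
    [exact: ltn_trans|exact: ltnn].
by move/card_uniqP => /= <-; rewrite -[X in (_ <= X)%N]card_ord max_card.
Qed.

Lemma prod_path_weight l s d :
  \prod_(j < size s) G (nth d (l :: s) j.+1) (nth d (l :: s) j) = path_weight l s.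
Proof.
elim: s l => [|a s IHs] l; first by rewrite big_ord0.
by rewrite big_ord_recl /= -IHs.
Qed.

Lemma path_sum0 f i l : path_sum 0 f i l = f.[mu l] *+ (l == i).
Proof.
rewrite /path_sum big_mkcond (big_pred1 [tuple]) => [|t]; last exact/esym/eqP/tuple0.
by rewrite /= mul1r ddiff1; case: (l == i).
Qed.

Lemma path_sumS k f i l : path_sum k.+1 f i l =
  \sum_a \sum_(t : k.-tuple 'I_r.+1 | last a t == i)
     G a l * path_weight a t * ddiff f (map mu [:: l, a & t]).
Proof.
rewrite pair_big_dep /= /path_sum.
rewrite (reindex (fun p : 'I_r.+1 * k.-tuple 'I_r.+1 => [tuple of p.1 :: p.2])) //=.
exists (fun t : k.+1.-tuple 'I_r.+1 => (thead t, [tuple of behead t])) => [[a t]|t] _ /=.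
  by congr pair; apply/val_inj.
by apply/val_inj; rewrite /= [in RHS](tuple_eta t).
Qed.

(** The Leibniz rule at the first node of each path: either the node [mu l] is kept as a factor, or
    it is dropped and the path starts one step later. This mirrors right multiplication by
    $\operatorname{diag}(\mu) + G$. *)
Lemma path_sum_mulX k f i l :
  path_sum k.+1 (f * 'X) i l =
  path_sum k.+1 f i l * mu l + \sum_a path_sum k f i a * G a l.
Proof.
rewrite !path_sumS mulr_suml -big_split /=; apply: eq_bigr => a _.
rewrite /path_sum !mulr_suml -big_split /=; apply: eq_bigr => t _.
by rewrite ddiff_mulX //=; ring.
Qed.

Lemma path_sumC k c i l : path_sum k.+1 c%:P i l = 0.
Proof.
by rewrite path_sumS big1 // => a _; rewrite big1 // => t _; rewrite ddiffC ?mulr0.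
Qed.

Lemma path_sumD k f g i l : path_sum k (f + g) i l = path_sum k f i l + path_sum k g i l.
Proof. by rewrite -big_split /=; apply: eq_bigr => t _; rewrite ddiffD mulrDr. Qed.

Lemma path_sum_large f i l : \sum_a path_sum r f i a * G a l = 0.
Proof.
apply: big1 => a _; rewrite mulr_suml big1 // => t _.
have := @path_weight_size l (a :: t); rewrite /= size_tuple ltnSn => /(_ isT).
by move=> w0; rewrite mulrAC [_ * G a l]mulrC w0 mul0r.
Qed.

(** Descloux's formula, by induction along Horner's scheme: both sides obey the same recursion under
    multiplication by $X$ and addition of a constant. *)
Lemma horner_mx_path_sum f i l :
  horner_mx (diag_mx (\row_i mu i) + G) f i l = \sum_(k < r.+1) path_sum k f i l.
Proof.
elim/poly_ind: f i l => [|f c IHf] i l.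
  rewrite rmorph0 mxE big1 // => k _; rewrite /path_sum big1 // => t _.
  by rewrite /ddiff mod0p coef0 mulr0.
rewrite rmorphD rmorphM /= horner_mx_X horner_mx_C [LHS]mxE [X in X + _]mxE.
under [RHS]eq_bigr do rewrite path_sumD.
rewrite big_split /=; congr (_ + _); last first.
  rewrite big_ord_recl path_sum0 big1 => [|k _]; last exact: path_sumC.
  by rewrite addr0 hornerC mxE eq_sym.
have -> : \sum_j horner_mx (diag_mx (\row_i mu i) + G) f i j *
       (diag_mx (\row_i mu i) + G) j l =
     \sum_(k < r.+1) path_sum k f i l * mu l
     + \sum_(k < r.+1) \sum_a path_sum k f i a * G a l.
  rewrite -mulr_suml -IHf; set H := horner_mx _ f; set D := diag_mx _.
  have -> : \sum_(k < r.+1) \sum_a path_sum k f i a * G a l = \sum_a H i a * G a l.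
    by rewrite exchange_big; apply: eq_bigr => a _ /=; rewrite IHf mulr_suml.
  rewrite (eq_bigr (fun j => H i j * D j l + H i j * G j l)); last first.
    by move=> j _; rewrite mxE mulrDr.
  rewrite big_split /=; congr (_ + _).
  rewrite (bigD1 l) //= big1 => [|j jl]; last by rewrite !mxE (negbTE jl) mulr0.
  by rewrite addr0 [D l l]mxE eqxx mxE.
(* The [G] sum is shifted by one: its term [k] joins the paths with [k.+1] steps, and its last term
   vanishes because those paths are too long. *)
rewrite big_ord_recl [X in _ + X]big_ord_recr /= path_sum_large addr0.
rewrite [RHS]big_ord_recl -addrA -big_split /=; congr (_ + _).
  by rewrite !path_sum0 hornerM hornerX mulrnAl.
by apply: eq_bigr => k _; rewrite path_sum_mulX.
Qed.

Lemma path_sum_ge k f (i l : 'I_r.+1) : (i <= l)%N -> path_sum k.+1 f i l = 0.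
Proof.
move=> il; apply: big1 => t /eqP ti; apply: contraTeq il.
rewrite mulf_eq0 negb_or => /andP[/path_weight_neq0 pt _]; rewrite -ltnNge.
have tr : transitive (fun a b : 'I_r.+1 => a < b)%N by move=> b a c; exact: ltn_trans.
have := order_path_min tr pt.
move=> /allP; apply; rewrite -ti.
by case/tupleP: t {ti pt} => a t; rewrite /= mem_last.
Qed.

End PathSums.

Section Block.
Variable R : realType.
Local Notation C := R[i].

Definition node_mx r (mu : r.-tuple C) (G : 'M[C]_r) : 'M[C]_r :=
  diag_mx (\row_i tnth mu i) + G.

Lemma Qmx_mxpoly_at n r (mu : r.+1.-tuple C) (G : 'M[C]_r.+1) (P : 'M[{poly C}]_n) :
  strictly_lower r.+1 G -> Qmx mu G P = mxpoly_at (node_mx mu G) P.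
Proof.
move=> lowG; apply: eq_mxblock => i l; apply/matrixP => a b.
rewrite [RHS]mxE horner_mx_path_sum // /Qblock; case: ltnP => [li|il].
  rewrite summxE; apply: eq_bigr => k _; rewrite summxE.
  (* An admissible sequence starts with [l], so only its tail varies; tails that break monotonicity
     carry weight zero. *)
  rewrite (reindex_onto (fun t : k.-tuple 'I_r.+1 => [tuple of l :: t])
            (fun t => [tuple of behead t])); last first.
    move=> t /and3P[_ /eqP hl _]; apply/val_inj => /=.
    by case/tupleP: t hl => x t /= ->.
  rewrite big_mkcond [RHS]big_mkcond; apply: eq_bigr => t _ /=.
  rewrite eqxx /= -[in X in _ && X]val_eqE /= eqxx andbT.
  have -> : \prod_(j < k) G (nth l (l :: t) j.+1) (nth l (l :: t) j) = path_weight G l t.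
    by rewrite -(prod_path_weight G l t l) size_tuple.
  have [pt|npt] /= := boolP (path _ l t); last first.
    case: ifP => // _; have /eqP-> : path_weight G l t == 0.
      by apply: contraNT npt => /path_weight_neq0; exact.
    by rewrite mul0r.
  by case: ifP => // _; rewrite mxE divdiffE.
(* On and above the diagonal only the path without steps can contribute. *)
rewrite big_ord_recl path_sum0 big1 => [|k _]; last exact: path_sum_ge.
by rewrite addr0 eq_sym; case: eqVneq => [->|_]; rewrite mxE.
Qed.

End Block.

Local Open Scope sesquilinear_scope.

(** * Hermitian forms *)

Section Norms.
Variable R : realType.
Local Notation C := R[i].
Local Notation normc := ComplexField.Normc.normc.
Local Notation Re := complex.Re.

Definition nsq n (x : 'cV[C]_n) : R := \sum_i normc (x i 0) ^+ 2.

Definition rform n (H : 'M[C]_n) (x : 'cV[C]_n) : R := Re ((x^t* *m H *m x) 0 0).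

Lemma normcE (z : C) : `|z| = (normc z)%:C%C.
Proof. by case: z => a b; rewrite normc_def. Qed.

Lemma normc_ge0 (z : C) : 0 <= normc z.
Proof. by case: z => a b; rewrite sqrtr_ge0. Qed.

Lemma normc_sqr (z : C) : ((normc z) ^+ 2)%:C%C = z^* * z.
Proof. by rewrite rmorphXn /= -normcE normCK mulrC. Qed.

Lemma nsqE n (x : 'cV[C]_n) : (nsq x)%:C%C = (x^t* *m x) 0 0.
Proof.
rewrite rmorph_sum mxE; apply: eq_bigr => i _ /=.
by rewrite normc_sqr !mxE.
Qed.

Lemma nsq_rform n (x : 'cV[C]_n) : nsq x = rform 1%:M x.
Proof. by rewrite /rform mulmx1 -nsqE. Qed.

Lemma nsq_ge0 n (x : 'cV[C]_n) : 0 <= nsq x.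
Proof. by apply: sumr_ge0 => i _; rewrite sqr_ge0. Qed.

Lemma l2norm_nsq n (x : 'cV[C]_n) : l2norm x = Num.sqrt (nsq x).
Proof. by []. Qed.

Lemma l2norm_sqr n (x : 'cV[C]_n) : l2norm x ^+ 2 = nsq x.
Proof. by rewrite sqr_sqrtr // nsq_ge0. Qed.

Lemma l2norm_ge0 n (x : 'cV[C]_n) : 0 <= l2norm x.
Proof. exact: sqrtr_ge0. Qed.

Lemma nsq_eq0 n (x : 'cV[C]_n) : (nsq x == 0) = (x == 0).
Proof.
rewrite psumr_eq0 => [|i _]; last by rewrite sqr_ge0.
apply/allP/eqP => [x0|-> i _]; last first.
  by apply/implyP => _; rewrite mxE [normc _]ComplexField.Normc.normc0 expr0n.
apply/colP => i; rewrite mxE; apply: ComplexField.Normc.eq0_normc.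
by have /implyP/(_ isT) := x0 i (mem_index_enum _); rewrite expf_eq0 => /eqP.
Qed.

Lemma nsq0 n : nsq (0 : 'cV[C]_n) = 0.
Proof. by apply/eqP; rewrite nsq_eq0. Qed.

Lemma nsq_gt0 n (x : 'cV[C]_n) : x != 0 -> 0 < nsq x.
Proof. by move=> x0; rewrite lt_neqAle nsq_ge0 eq_sym nsq_eq0 x0. Qed.

Lemma nsqZ n a (x : 'cV[C]_n) : nsq (a *: x) = normc a ^+ 2 * nsq x.
Proof.
rewrite mulr_sumr; apply: eq_bigr => i _.
by rewrite mxE ComplexField.Normc.normcM exprMn.
Qed.

Lemma nsqN n (x : 'cV[C]_n) : nsq (- x) = nsq x.
Proof.
apply: eq_bigr => i _; rewrite mxE.
by case: (x i 0) => a b; rewrite /= !sqrrN.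
Qed.

Lemma conjmxM m n p (A : 'M[C]_(m, n)) (B : 'M[C]_(n, p)) :
  (A *m B)^t* = B^t* *m A^t*.
Proof. by rewrite trmx_mul map_mxM. Qed.

Lemma conjmxD m n (A B : 'M[C]_(m, n)) : (A + B)^t* = A^t* + B^t*.
Proof. by apply/matrixP => i j; rewrite !mxE rmorphD. Qed.

Lemma conjmxZ m n a (A : 'M[C]_(m, n)) : (a *: A)^t* = a^* *: A^t*.
Proof. by apply/matrixP => i j; rewrite !mxE rmorphM. Qed.

Lemma conjmx1 n : (1%:M : 'M[C]_n)^t* = 1%:M.
Proof. by rewrite trmx1 map_mx1. Qed.

Lemma nsqM m n (A : 'M[C]_(m, n)) (x : 'cV[C]_n) :
  nsq (A *m x) = rform (A^t* *m A) x.
Proof. by rewrite nsq_rform /rform mulmx1 conjmxM !mulmxA. Qed.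

Lemma Re_conj (z : C) : Re z^* = Re z.
Proof. by case: z. Qed.

Lemma Re_le_normc (z : C) : `|Re z| <= normc z.
Proof.
case: z => a b /=; rewrite -sqrtr_sqr ler_wsqrtr // lerDl; exact: sqr_ge0.
Qed.

Lemma Re_mul_real (a : R) (z : C) : Re (a%:C%C * z) = a * Re z.
Proof. by case: z => u v /=; rewrite mul0r subr0. Qed.

Lemma rformD n (H1 H2 : 'M[C]_n) x : rform (H1 + H2) x = rform H1 x + rform H2 x.
Proof. by rewrite /rform mulmxDr mulmxDl mxE raddfD. Qed.

Lemma rformZ n (a : R) (H : 'M[C]_n) x : rform (a%:C%C *: H) x = a * rform H x.
Proof. by rewrite /rform -scalemxAr -scalemxAl mxE Re_mul_real. Qed.

Lemma rform_conj n (H : 'M[C]_n) x : rform (H^t*) x = rform H x.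
Proof.
rewrite /rform -[RHS]Re_conj; congr Re.
have -> : ((x^t* *m H *m x) 0 0)^* = (x^t* *m H *m x)^t* 0 0 by rewrite !mxE.
by rewrite !conjmxM trmxCK mulmxA.
Qed.

Lemma normc_coord n (x : 'cV[C]_n) i : normc (x i 0) <= l2norm x.
Proof.
rewrite -(@ler_pXn2r _ 2) ?nnegrE ?normc_ge0 ?l2norm_ge0 // l2norm_sqr.
rewrite /nsq (bigD1 i) //= lerDl; apply: sumr_ge0 => j _; exact: sqr_ge0.
Qed.

Lemma bilinear_bound m n (H : 'M[C]_(m, n)) : exists2 K, 0 <= K &
  forall x y, normc ((x^t* *m H *m y) 0 0) <= K * l2norm x * l2norm y.
Proof.
exists (\sum_j \sum_i normc (H i j)) => [|x y].
  by apply: sumr_ge0 => j _; apply: sumr_ge0 => i _; exact: normc_ge0.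
rewrite -lecR -normcE mxE -mulrA mulr_suml rmorph_sum /=.
apply: le_trans (ler_norm_sum _ _ _) _; apply: ler_sum => j _.
rewrite normrM [X in `|X| * _]mxE [X in _ * X]normcE mulr_suml rmorph_sum /=.
apply: le_trans (_ : (\sum_i `|x^t* 0 i * H i j|) * (normc (y j 0))%:C%C <= _).
  by apply: ler_wpM2r; [rewrite ler0c normc_ge0 | exact: ler_norm_sum].
rewrite mulr_suml; apply: ler_sum => i _.
rewrite normrM !mxE norm_conjC !normcE -!rmorphM /= lecR.
rewrite -mulrA mulrCA ler_wpM2l ?normc_ge0 //.
by apply: ler_pM; rewrite ?normc_ge0 ?normc_coord.
Qed.

Lemma l2norm_delta n (i : 'I_n) : l2norm (delta_mx i 0 : 'cV[C]_n) = 1.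
Proof.
rewrite l2norm_nsq /nsq (bigD1 i) //= big1 => [|j ji].
  by rewrite mxE !eqxx [normc _]ComplexField.Normc.normc1 expr1n addr0 sqrtr1.
by rewrite mxE (negbTE ji) [normc _]ComplexField.Normc.normc0 expr0n.
Qed.

Lemma rformN n (H : 'M[C]_n) x : rform (- H) x = - rform H x.
Proof.
have -> : - H = (-1)%:C%C *: H by rewrite rmorphN1 scaleN1r.
by rewrite rformZ mulN1r.
Qed.

Lemma nsq_bound n (F : 'M[C]_n) : exists2 K, 0 <= K & forall x, nsq (F *m x) <= K * nsq x.
Proof.
have [K K0 KE] := bilinear_bound (F^t* *m F); exists K => // x.
rewrite nsqM -[nsq x]l2norm_sqr expr2 mulrA.
exact: le_trans (ler_norm _) (le_trans (Re_le_normc _) (KE x x)).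
Qed.

Lemma nsq_1D n (F : 'M[C]_n) (t : R) (x : 'cV[C]_n) :
  nsq ((1%:M + t%:C%C *: F) *m x) =
  nsq x + 2 * t * rform F x + t ^+ 2 * nsq (F *m x).
Proof.
have tJ : (t%:C%C : C)^* = t%:C%C by rewrite [LHS]conjc_real.
have E : (1%:M + t%:C%C *: F)^t* *m (1%:M + t%:C%C *: F) =
    1%:M + t%:C%C *: F + t%:C%C *: F^t* + (t ^+ 2)%:C%C *: (F^t* *m F).
  rewrite conjmxD conjmxZ conjmx1 tJ mulmxDl !mulmxDr !mul1mx mulmx1.
  rewrite -scalemxAl -scalemxAr scalerA -rmorphM /= -expr2.
  by rewrite -!addrA.
rewrite nsqM E !rformD !rformZ rform_conj -nsq_rform -nsqM.
by ring.
Qed.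

Lemma rform_lower_bound n (H : 'M[C]_n) (K : R) (V w : 'cV[C]_n) (a : C) :
    (forall x y, normc ((x^t* *m H *m y) 0 0) <= K * l2norm x * l2norm y) ->
    l2norm V = 1 ->
  rform H V * normc a ^+ 2 - 2 * K * normc a * l2norm w - K * l2norm w ^+ 2
  <= rform H (a *: V + w).
Proof.
move=> KH V1.
have E : ((a *: V + w)^t* *m H *m (a *: V + w)) 0 0 =
   ((normc a) ^+ 2)%:C%C * ((V^t* *m H *m V) 0 0) + a^* * ((V^t* *m H *m w) 0 0)
   + a * ((w^t* *m H *m V) 0 0) + (w^t* *m H *m w) 0 0.
  rewrite conjmxD conjmxZ !mulmxDl !mulmxDr -!scalemxAl -!scalemxAr normc_sqr.
  have D (A B : 'M[C]_1) : (A + B) 0 0 = A 0 0 + B 0 0 by rewrite mxE.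
  have Z c (A : 'M[C]_1) : (c *: A) 0 0 = c * A 0 0 by rewrite mxE.
  by rewrite !(D, Z) mulrA addrA.
rewrite /rform E !raddfD /= (Re_mul_real (normc a ^+ 2)).
have b1 : `|Re (a^* * ((V^t* *m H *m w) 0 0))| <= K * normc a * l2norm w.
  apply: le_trans (Re_le_normc _) _; rewrite ComplexField.Normc.normcM.
  have -> : normc a^* = normc a by case: (a) => u v; rewrite /= sqrrN.
  have := KH V w; rewrite V1 mulr1 => /(ler_wpM2l (normc_ge0 a)).
  by rewrite [_ * (K * _)]mulrCA mulrA.
have b2 : `|Re (a * ((w^t* *m H *m V) 0 0))| <= K * normc a * l2norm w.
  apply: le_trans (Re_le_normc _) _; rewrite ComplexField.Normc.normcM.
  have := KH w V; rewrite V1 mulr1 => /(ler_wpM2l (normc_ge0 a)).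
  by rewrite [_ * (K * _)]mulrCA mulrA.
have b3 : `|Re ((w^t* *m H *m w) 0 0)| <= K * l2norm w ^+ 2.
  by apply: le_trans (Re_le_normc _) _; rewrite expr2 mulrA.
move: b1 b2 b3; rewrite !ler_norml => /andP[b1 _] /andP[b2 _] /andP[b3 _].
lra.
Qed.

End Norms.

(** * Singular values *)

Lemma count_lt_nth_sort (R : realDomainType) (s : seq R) k :
  (k < size s)%N -> (count (fun x => x < nth 0 (sort <=%R s) k)%R s <= k)%N.
Proof.
move=> ks; rewrite leqNgt -(permP (permEl (perm_sort <=%R s))); apply/negP.
by move/(nth_count_lt 0 (sort_le_sorted s)); rewrite ltxx.
Qed.

Lemma count_gt_nth_sort (R : realDomainType) (s : seq R) k :
  (k < size s)%N ->
  (count (fun x => nth 0 (sort <=%R s) k < x)%R s + k < size s)%N.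
Proof.
move=> ks; rewrite -(permP (permEl (perm_sort <=%R s))) ltnNge -leq_subLR.
rewrite -(size_sort <=%R s); apply/negP => sk.
have := @nth_count_gt _ _ (nth 0 (sort <=%R s) k) 0 _ k (sort_le_sorted s).
by rewrite count_le_gt sk size_sort ks ltxx => /(_ isT).
Qed.

Lemma exists_common_kernel (F : fieldType) n p q (A : 'M[F]_(p, n)) (B : 'M[F]_(q, n)) :
    (\rank A + \rank B < n)%N ->
  exists x : 'cV[F]_n, [/\ x != 0, A *m x = 0 & B *m x = 0].
Proof.
move=> rAB; pose M := col_mx A B.
have /rowV0Pn[v /sub_kermxP vM v0] : kermx M^T != 0.
  rewrite -mxrank_eq0 mxrank_ker mxrank_tr -lt0n subn_gt0.
  by apply: leq_ltn_trans rAB; rewrite -addsmxE mxrank_adds_leqif.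
have /eqP : M *m v^T = 0 by apply: trmx_inj; rewrite trmx_mul trmxK vM trmx0.
rewrite mul_col_mx col_mx_eq0 => /andP[/eqP Av /eqP Bv].
by exists v^T; split => //; rewrite trmx_eq0.
Qed.

Section SingularValues.
Variable R : realType.
Local Notation C := R[i].
Local Notation normc := ComplexField.Normc.normc.
Local Notation Re := complex.Re.
Variables (n : nat) (M : 'M[C]_n).

(** Its rows are the conjugate transposes of right singular vectors. [sval] keeps the singular
    values unsorted, attached to these rows. *)
Definition svec := spectralmx (M^t* *m M).
Definition sval (i : 'I_n) : R :=
  Num.sqrt (Re (spectral_diag (M^t* *m M) 0 i)).

Lemma svec_unitary : svec^t* *m svec = 1%:M.
Proof.
have /unitarymxP := spectral_unitarymx (M^t* *m M).
by move/mulmx1C.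
Qed.

Lemma svecVK m (A : 'M[C]_(n, m)) : svec *m (svec^t* *m A) = A.
Proof. by rewrite mulmxA (mulmx1C svec_unitary) mul1mx. Qed.

Lemma nsq_svec (x : 'cV[C]_n) : nsq (svec *m x) = nsq x.
Proof. by rewrite nsqM svec_unitary -nsq_rform. Qed.

Lemma gram_svec : M^t* *m M =
  svec^t* *m diag_mx (spectral_diag (M^t* *m M)) *m svec.
Proof.
rewrite -invmx_unitary ?spectral_unitarymx //.
by apply/orthomx_spectralP/normalmxP; rewrite conjmxM trmxCK.
Qed.

Lemma gram_form (x : 'cV[C]_n) :
  (x^t* *m (M^t* *m M) *m x) 0 0 =
  \sum_i spectral_diag (M^t* *m M) 0 i * (normc ((svec *m x) i 0) ^+ 2)%:C%C.
Proof.
rewrite {1}gram_svec !mulmxA -conjmxM -!mulmxA mulmxA mxE; apply: eq_bigr => i _.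
by rewrite mul_mx_diag mxE mulrC mulrCA mulrA normc_sqr !mxE mulrC mulrA.
Qed.

(** The eigenvalue is $\|Mx\|^2$ for its unit eigenvector $x$, so taking the real part and the
    square root loses nothing. *)
Lemma sval_sqr i : spectral_diag (M^t* *m M) 0 i = (sval i ^+ 2)%:C%C.
Proof.
set d := spectral_diag _; pose x := svec^t* *m delta_mx i 0 : 'cV[C]_n.
have dE : d 0 i = (nsq (M *m x))%:C%C.
  rewrite nsqE conjmxM mulmxA -[_ *m _ *m M]mulmxA gram_form -/d svecVK.
  rewrite (bigD1 i) //= big1 => [|j ji].
    by rewrite mxE !eqxx addr0 [normc _]ComplexField.Normc.normc1 expr1n mulr1.
  by rewrite mxE (negbTE ji) [normc _]ComplexField.Normc.normc0 expr0n mulr0.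
by rewrite /sval -/d sqr_sqrtr dE //= nsq_ge0.
Qed.

Lemma nsq_mul (x : 'cV[C]_n) :
  nsq (M *m x) = \sum_i sval i ^+ 2 * normc ((svec *m x) i 0) ^+ 2.
Proof.
apply: (@complexI R); rewrite nsqE conjmxM mulmxA -[_ *m _ *m M]mulmxA gram_form.
rewrite rmorph_sum; apply: eq_bigr => i _.
by rewrite /= sval_sqr -rmorphM.
Qed.

Lemma sval_ge0 i : 0 <= sval i. Proof. exact: sqrtr_ge0. Qed.

Lemma singular_valuesE : singular_values M = sort <=%R (map sval (enum 'I_n)).
Proof. by []. Qed.

Lemma card_sval (p : pred R) : count p (map sval (enum 'I_n)) = #|[pred i | p (sval i)]|.
Proof. by rewrite count_map -size_filter cardE enumT. Qed.

(* Coordinates in the basis of right singular vectors whose singular value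
   satisfies [p]. *)
Definition scoords (p : pred R) : 'M[C]_(#|[pred i | p (sval i)]|, n) :=
  \matrix_k row (enum_val k) svec.

Lemma rank_scoords p : (\rank (scoords p) <= #|[pred i | p (sval i)]|)%N.
Proof. exact: rank_leq_row. Qed.

Lemma scoords_eq0 p (x : 'cV[C]_n) i : scoords p *m x = 0 -> p (sval i) ->
  (svec *m x) i 0 = 0.
Proof.
move=> px pi; have ip : i \in [pred i | p (sval i)] by [].
have /matrixP/(_ (enum_rank_in ip i) 0) := px.
rewrite [X in _ = X]mxE => px0; apply: etrans px0; rewrite !mxE; apply: eq_bigr => j _.
by rewrite !mxE enum_rankK_in.
Qed.

Variable k : nat.
Hypotheses (k_gt0 : (0 < k)%N) (k_le : (k <= n)%N).
Let sigma := sigma_min k M.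

Lemma sigma_min_ge0 : 0 <= sigma.
Proof.
rewrite /sigma /sigma_min singular_valuesE.
have : nth 0 (sort <=%R (map sval (enum 'I_n))) k.-1 \in map sval (enum 'I_n).
  rewrite -(mem_sort <=%R) mem_nth // size_sort size_map size_enum_ord.
  by rewrite prednK.
by case/mapP => i _ ->; exact: sval_ge0.
Qed.

Lemma card_sval_lt : (#|[pred i | (sval i < sigma)%R]| < k)%N.
Proof.
rewrite -(card_sval (fun x => x < sigma)) -[X in (_ < X)%N](prednK k_gt0) ltnS.
by apply: count_lt_nth_sort; rewrite size_map size_enum_ord prednK.
Qed.

Lemma card_sval_gt : (#|[pred i | (sigma < sval i)%R]| + k <= n)%N.
Proof.
rewrite -(card_sval (fun x => sigma < x)) -[X in (_ + X)%N](prednK k_gt0) addnS.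
have := @count_gt_nth_sort _ (map sval (enum 'I_n)) k.-1.
by rewrite size_map size_enum_ord prednK //; apply.
Qed.

(* Both bounds are Courant-Fischer arguments: the linear conditions are too few
   to exclude a nonzero vector [x]. *)
Lemma sigma_min_le (D : 'M[C]_n) (d : R) : 0 <= d ->
    (forall x, nsq (D *m x) <= d ^+ 2 * nsq x) ->
    (\rank (M + D)%R + k <= n)%N ->
  sigma <= d.
Proof.
move=> d0 Dd rk.
have [|x [x0 sx MDx]] := @exists_common_kernel _ _ _ _ (scoords (fun y => y < sigma)) (M + D).
  apply: leq_ltn_trans (leq_add (rank_scoords _) (leqnn _)) _.
  by rewrite addnC; apply: leq_trans rk; rewrite ltn_add2l card_sval_lt.
have : sigma ^+ 2 * nsq x <= d ^+ 2 * nsq x.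
  apply: le_trans (Dd x).
  have -> : D *m x = - (M *m x).
    by apply/eqP; rewrite -addr_eq0 addrC -mulmxDl MDx.
  rewrite nsqN nsq_mul -[X in _ * X <= _]nsq_svec mulr_sumr.
  apply: ler_sum => i _.
  have [si|si] := ltP (sval i) sigma.
    rewrite (scoords_eq0 sx si) [normc _]ComplexField.Normc.normc0.
    by rewrite expr0n !mulr0.
  by rewrite ler_wpM2r ?sqr_ge0 // ler_sqr ?nnegrE ?sval_ge0 ?sigma_min_ge0.
by rewrite ler_pM2r ?nsq_gt0 // ler_sqr ?nnegrE ?sigma_min_ge0.
Qed.

Lemma lt_sigma_min q (B : 'M[C]_(q, n)) (c : R) : 0 <= c -> (\rank B < k)%N ->
    (forall x, x != 0 -> B *m x = 0 -> c ^+ 2 * nsq x < nsq (M *m x)) ->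
  c < sigma.
Proof.
move=> c0 rB cB.
have [|x [x0 sx Bx]] := @exists_common_kernel _ _ _ _ (scoords (fun y => sigma < y)) B.
  apply: leq_ltn_trans (leq_add (rank_scoords _) (leqnn _)) _.
  by apply: leq_trans card_sval_gt; rewrite ltn_add2l.
have : c ^+ 2 * nsq x < sigma ^+ 2 * nsq x.
  apply: lt_le_trans (cB x x0 Bx) _.
  rewrite nsq_mul -[X in _ <= _ * X]nsq_svec mulr_sumr; apply: ler_sum => i _.
  have [si|si] := ltP sigma (sval i).
    rewrite (scoords_eq0 sx si) [normc _]ComplexField.Normc.normc0.
    by rewrite expr0n !mulr0.
  by rewrite ler_wpM2r ?sqr_ge0 // ler_sqr ?nnegrE ?sval_ge0 ?sigma_min_ge0.
by rewrite ltr_pM2r ?nsq_gt0 // ltr_sqr ?nnegrE ?sigma_min_ge0.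
Qed.

End SingularValues.

(** * First-order perturbation of a simple singular value *)

(* [a] and [w] stand for the norms of the components of a vector along the
   singular vector and orthogonal to it, [g] for the spectral gap, and [rho]
   for the first-order increase; [4 * t * K * a * w] is absorbed by AM-GM. *)
Lemma small_step_pos (R : realFieldType) (g rho K K2 m : R) :
    0 < g -> 0 < rho -> 0 <= K -> 0 <= K2 -> 0 <= m ->
  exists t, [/\ 0 < t, t * m < 1 & forall a w, 0 <= a -> 0 <= w ->
    (0 < a) || (0 < w) ->
    0 < g * w ^+ 2 + 2 * t * (rho * a ^+ 2 - 2 * K * a * w - K * w ^+ 2)
        - t ^+ 2 * K2 * (a ^+ 2 + w ^+ 2)].
Proof.
move=> g0 rho0 K0 K20 m0.
pose b := K2 / rho; pose E := K ^+ 2 / rho; pose c := (2 * K + 4 * E + K2) / g.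
have b0 : 0 <= b by rewrite divr_ge0 // ltW.
have E0 : 0 <= E by rewrite divr_ge0 ?sqr_ge0 // ltW.
have c0 : 0 <= c by rewrite divr_ge0 ?(ltW g0) //; lra.
have D0 : 0 < 1 + m + b + c by lra.
(* With this choice the nonnegative numbers [t], [t * m], [t * b], [t * c] sum to 1. *)
pose t := (1 + m + b + c)^-1.
have t0 : 0 < t by rewrite invr_gt0.
have tD : t * (1 + m + b + c) = 1 by rewrite mulVf // gt_eqF.
have tm : 0 <= t * m by rewrite mulr_ge0 // ltW.
have tb : 0 <= t * b by rewrite mulr_ge0 // ltW.
have tc : 0 <= t * c by rewrite mulr_ge0 // ltW.
have t1 : t <= 1 by lra.
have bE : b * rho = K2 by rewrite /b divfK // gt_eqF.
exists t; split => // [|a w a0 w0 aw]; first by lra.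
have tb1 : 0 < 1 - t * b by lra.
have tc1 : 0 < 1 - t * c by lra.
(* Half of [2 * t * rho * a ^+ 2] completes the square with the cross term; the square costs
   [4 * t * E * w ^+ 2], which is budgeted in [c]. *)
have -> : g * w ^+ 2 + 2 * t * (rho * a ^+ 2 - 2 * K * a * w - K * w ^+ 2)
        - t ^+ 2 * K2 * (a ^+ 2 + w ^+ 2) =
   (1 - t * b) * (t * rho * a ^+ 2) + (1 - t * c) * (g * w ^+ 2)
   + t * (1 - t) * K2 * w ^+ 2 + t / rho * (rho * a - 2 * K * w) ^+ 2.
  have -> : K2 = b * rho by [].
  have rn : rho != 0 by rewrite gt_eqF.
  have gn : g != 0 by rewrite gt_eqF.
  by rewrite /c /E -bE; field; rewrite rn gn.
have p3 : 0 <= t * (1 - t) * K2 * w ^+ 2.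
  by rewrite !mulr_ge0 ?sqr_ge0 ?subr_ge0 // ltW.
have p4 : 0 <= t / rho * (rho * a - 2 * K * w) ^+ 2.
  by rewrite mulr_ge0 ?sqr_ge0 // divr_ge0 // ltW.
have p1 : 0 <= (1 - t * b) * (t * rho * a ^+ 2).
  by rewrite !mulr_ge0 ?sqr_ge0 // ltW.
have p2 : 0 <= (1 - t * c) * (g * w ^+ 2).
  by rewrite !mulr_ge0 ?sqr_ge0 // ltW.
case/orP: aw => pos.
  have : 0 < (1 - t * b) * (t * rho * a ^+ 2) by rewrite !mulr_gt0 ?exprn_gt0.
  lra.
have : 0 < (1 - t * c) * (g * w ^+ 2) by rewrite !mulr_gt0 ?exprn_gt0.
lra.
Qed.

Section Perturbation.
Variable R : realType.
Local Notation C := R[i].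
Local Notation normc := ComplexField.Normc.normc.

Variables (n : nat) (M F : 'M[C]_n) (k : nat).
Hypotheses (k_gt0 : (0 < k)%N) (k_le : (k <= n)%N).
Let sigma := sigma_min k M.
Variable i0 : 'I_n.
Hypotheses (si0 : sval M i0 = sigma) (uniq_i0 : forall i, sval M i = sigma -> i = i0).
Let V : 'cV[C]_n := (svec M)^t* *m delta_mx i0 0.

Lemma svecV : svec M *m V = delta_mx i0 0.
Proof. by rewrite svecVK. Qed.

Lemma l2norm_svecV : l2norm V = 1.
Proof.
by rewrite l2norm_nsq -(nsq_svec M) svecV -l2norm_nsq l2norm_delta.
Qed.

Lemma gram_svecV : M^t* *m M *m V = (sigma ^+ 2)%:C%C *: V.
Proof.
rewrite gram_svec -!mulmxA svecV /V scalemxAr; congr (_ *m _).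
apply/colP => i; rewrite mul_diag_mx !mxE.
by case: eqVneq => [->|_]; rewrite ?mulr0 // !mulr1 sval_sqr si0.
Qed.

Lemma sval_gap : exists2 g, 0 < g & forall i, sigma < sval M i ->
  g <= sval M i ^+ 2 - sigma ^+ 2.
Proof.
(* The default 1 covers the case where no singular value exceeds [sigma]. *)
exists (\big[Order.min/1]_(i | sigma < sval M i) (sval M i ^+ 2 - sigma ^+ 2)).
  apply/bigmin_gtP; split => // i si.
  by rewrite subr_gt0 ltr_sqr ?nnegrE ?sval_ge0 ?sigma_min_ge0.
by move=> i si; exact: bigmin_le_cond.
Qed.

(** Write $y = aV + w$ with $w$ in the directions of larger singular values, the smaller ones being
    excluded. The first-order gain dominates along $V$ and the spectral gap on $w$. The bound
    [t * m < 1] later makes the similarity invertible. *)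
Lemma sigma_min_perturb (m : R) : 0 <= m ->
    sigma ^+ 2 * rform F V < rform F (M *m V) ->
  exists t, [/\ 0 < t, t * m < 1 & forall y, y != 0 ->
    scoords M (fun s => s < sigma) *m y = 0 ->
    sigma ^+ 2 * nsq ((1%:M + t%:C%C *: F) *m y) <
    nsq ((1%:M + t%:C%C *: F) *m (M *m y))].
Proof.
move=> m0 rho0; have [g g0 gE] := sval_gap.
have [K2 K20 K2E] := nsq_bound F.
(* [rform H y] is half the coefficient of [t] in the difference of the two sides to be compared. *)
pose H := M^t* *m F *m M + (- sigma ^+ 2)%:C%C *: F.
have [K K0 KE] := bilinear_bound H.
have HE y : rform H y = rform F (M *m y) - sigma ^+ 2 * rform F y.
  rewrite rformD rformZ mulNr; congr (_ - _).
  by rewrite /rform conjmxM !mulmxA.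
pose rho := rform H V.
have rho_gt0 : 0 < rho by rewrite /rho HE subr_gt0.
have [t [t0 tm tE]] := small_step_pos g0 rho_gt0 K0
   (mulr_ge0 (sqr_ge0 sigma) K20) m0.
exists t; split => // y y0 sy.
pose c := svec M *m y; pose a := c i0 0; pose w := y - a *: V.
have yE : y = a *: V + w by rewrite addrC subrK.
have wE : nsq w = \sum_(i | i != i0) normc (c i 0) ^+ 2.
  have cw i : (svec M *m w) i 0 = if i == i0 then 0 else c i 0.
    have sub (A B : 'cV[C]_n) j : (A - a *: B) j 0 = A j 0 - a * B j 0 by rewrite !mxE.
    rewrite mulmxBr -scalemxAr svecV -/c sub.
    rewrite [delta_mx _ _ _ _]mxE andbT.
    by case: eqP => [->|_]; rewrite ?mulr1 ?subrr // mulr0 subr0.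
  rewrite -(nsq_svec M) /nsq (bigD1 i0) //= cw eqxx [normc 0]ComplexField.Normc.normc0.
  by rewrite expr0n add0r; apply: eq_bigr => i /negbTE ii0; rewrite cw ii0.
have yaw : nsq y = normc a ^+ 2 + nsq w.
  by rewrite wE -(nsq_svec M) /nsq (bigD1 i0).
have gap : g * nsq w <= nsq (M *m y) - sigma ^+ 2 * nsq y.
  rewrite nsq_mul -(nsq_svec M y) -/c [nsq c]/nsq [X in _ - X]mulr_sumr -sumrB.
  rewrite (bigD1 i0) //= si0.
  rewrite subrr add0r wE mulr_sumr; apply: ler_sum => i ii0.
  rewrite -mulrBl; have [si|si|si] := ltgtP (sval M i) sigma.
  - by rewrite /c (scoords_eq0 sy si) [normc 0]ComplexField.Normc.normc0 expr0n !mulr0.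
  - by rewrite ler_wpM2r ?sqr_ge0 // gE.
  - by rewrite (uniq_i0 si) eqxx in ii0.
rewrite !nsq_1D.
have a_w : (0 < normc a) || (0 < l2norm w).
  rewrite !lt0r normc_ge0 l2norm_ge0 !andbT -negb_and; apply: contra y0.
  move=> /andP[/eqP a0 /eqP w0]; rewrite -nsq_eq0 yaw -(l2norm_sqr w) a0 w0.
  by rewrite expr0n addr0.
have := tE _ _ (normc_ge0 a) (l2norm_ge0 w) a_w; rewrite l2norm_sqr -yaw.
have := rform_lower_bound w a KE l2norm_svecV.
rewrite -yE (HE y) -/rho l2norm_sqr => /(ler_wpM2l (_ : 0 <= 2 * t)).
have tp : 0 <= 2 * t by rewrite mulr_ge0 // ltW.
move=> /(_ tp) hH hE.
have hK2 := ler_wpM2l (sqr_ge0 t) (ler_wpM2l (sqr_ge0 sigma) (K2E y)).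
have h1 := mulr_ge0 (sqr_ge0 t) (nsq_ge0 (F *m (M *m y))).
(* The difference is sorted by powers of [t]; the nonnegative term [t ^+ 2 * nsq (F *m (M *m y))] is
   discarded. *)
rewrite -subr_gt0.
have -> : nsq (M *m y) + 2 * t * rform F (M *m y) + t ^+ 2 * nsq (F *m (M *m y)) -
    sigma ^+ 2 * (nsq y + 2 * t * rform F y + t ^+ 2 * nsq (F *m y)) =
    (nsq (M *m y) - sigma ^+ 2 * nsq y) +
    2 * t * (rform F (M *m y) - sigma ^+ 2 * rform F y) +
    (t ^+ 2 * nsq (F *m (M *m y)) - t ^+ 2 * (sigma ^+ 2 * nsq (F *m y))) by ring.
apply: lt_le_trans hE _; apply: lerD; first exact: lerD.
rewrite -mulrA -[sigma ^+ 2 * K2 * _]mulrA.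
by apply: le_trans (_ : - (t ^+ 2 * (sigma ^+ 2 * nsq (F *m y))) <= _); rewrite ?lerN2 ?lerDr.
Qed.

End Perturbation.

(** * Triangular similarities and vectorization *)

Section Triangular.
Variables (F : fieldType) (n : nat).
Implicit Types A B S X : 'M[F]_n.

Lemma trig_mulmx A B : is_trig_mx A -> is_trig_mx B -> is_trig_mx (A *m B).
Proof.
move=> /is_trig_mxP tA /is_trig_mxP tB; apply/is_trig_mxP => i j ij.
rewrite mxE big1 // => k _; have [ik|ki] := ltnP i k; first by rewrite tA // mul0r.
by rewrite tB ?mulr0 // (leq_ltn_trans ki).
Qed.

Lemma trig_mulmx_diag A B i : is_trig_mx A -> is_trig_mx B ->
  (A *m B) i i = A i i * B i i.
Proof.
move=> /is_trig_mxP tA /is_trig_mxP tB.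
rewrite mxE (bigD1 i) //= big1 ?addr0 // => k; rewrite neq_ltn.
by case/orP => ki; [rewrite tB ?mulr0|rewrite tA ?mul0r].
Qed.

Lemma trig_unit_diag S i : is_trig_mx S -> S \in unitmx -> S i i != 0.
Proof. by move=> tS; rewrite unitmxE unitfE det_trig // => /prodf_neq0 ->. Qed.

Lemma trig_invmx S : is_trig_mx S -> S \in unitmx -> is_trig_mx (invmx S).
Proof.
move=> tS uS; have sd i := trig_unit_diag i tS uS.
(* Forward substitution: entry [i j] of the product with the inverse leaves only the diagonal term
   once the earlier rows are known. *)
apply/is_trig_mxP => i j; have [m] := ubnP i; elim: m i => // m IHm i im ij.
have := mulmxV uS => /matrixP/(_ i j); rewrite !mxE -val_eqE /= ltn_eqF //.
rewrite (bigD1 i) //= big1 ?addr0 => [/eqP|k].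
  by rewrite mulf_eq0 (negbTE (sd i)) => /eqP.
rewrite neq_ltn => /orP[ki|ik]; last by rewrite (is_trig_mxP tS) ?mul0r.
by rewrite (IHm k) ?mulr0 //; [exact: leq_trans ki im|exact: ltn_trans ki ij].
Qed.

Lemma trig_conj_diag S A i : is_trig_mx S -> S \in unitmx -> is_trig_mx A ->
  (S *m A *m invmx S) i i = A i i.
Proof.
move=> tS uS tA; have tV := trig_invmx tS uS.
rewrite !trig_mulmx_diag ?trig_mulmx // mulrAC -trig_mulmx_diag // mulmxV //.
by rewrite mxE eqxx mul1r.
Qed.

End Triangular.

Section Vec.
Variables (R : realType) (n r : nat).
Local Notation C := R[i].
Local Notation Re := complex.Re.

Definition unvec (v : 'cV[C]_(\sum_(i < r.+1) n)) : 'M[C]_(n, r.+1) :=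
  \matrix_(a, l) submxcol v l a 0.

Lemma unvecK v : vec (unvec v) = v.
Proof.
rewrite -[RHS]submxcolK; apply/eq_mxcol => l; apply/colP => a.
by rewrite !mxE.
Qed.

Lemma vec_dot (X Y : 'M[C]_(n, r.+1)) :
  ((vec X)^t* *m vec Y) 0 0 = \tr (X^t* *m Y).
Proof.
have -> : (vec X)^t* = \mxrow_l (col l X)^t*.
  by apply/matrixP => i j; rewrite !mxE.
rewrite /vec mul_mxrow_mxcol summxE; apply: eq_bigr => l _.
by rewrite !mxE; apply: eq_bigr => a _; rewrite !mxE.
Qed.

Lemma nsq_vec (X : 'M[C]_(n, r.+1)) : nsq (vec X) = \sum_l nsq (col l X).
Proof.
apply: (@complexI R); rewrite nsqE vec_dot rmorph_sum; apply: eq_bigr => l _ /=.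
by rewrite nsqE !mxE; apply: eq_bigr => a _; rewrite !mxE.
Qed.

Lemma kronmx_vec (E : 'M[C]_r.+1) (D : 'M[C]_n) (X : 'M[C]_(n, r.+1)) :
  kronmx E D *m vec X = vec (D *m X *m E^T).
Proof.
rewrite mul_mxblock_mxrow; apply/eq_mxcol => i; apply/colP => a.
rewrite summxE !mxE; apply: eq_bigr => l _.
by rewrite -scalemxAl colE mxE mulmxA -colE [col _ _ _ _]mxE [E^T _ _]mxE mulrC.
Qed.

Lemma vecZ c (X : 'M[C]_(n, r.+1)) : vec (c *: X) = c *: vec X.
Proof. by apply/colP => i; rewrite !mxE. Qed.

Lemma rform_kronmx_vec (E : 'M[C]_r.+1) (X : 'M[C]_(n, r.+1)) :
  rform (kronmx E 1%:M) (vec X) = Re (\tr (X^t* *m X *m E^T)).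
Proof. by rewrite /rform -mulmxA kronmx_vec mul1mx vec_dot mulmxA. Qed.

End Vec.

(** * Stationarity at the optimal parameters *)

Section Optimality.
Variables (R : realType) (n r : nat).
Local Notation C := R[i].
Local Notation normc := ComplexField.Normc.normc.
Local Notation Re := complex.Re.
Local Notation N := (\sum_(i < r.+1) n)%N.

Lemma leq_dim : (0 < n)%N -> (r.+1 <= N)%N.
Proof. by move=> n0; rewrite sum_nat_const card_ord leq_pmulr. Qed.

Lemma trig_node_mx (mu : r.+1.-tuple C) G :
  strictly_lower r.+1 G -> is_trig_mx (node_mx mu G).
Proof.
move=> lG; apply/is_trig_mxP => i j ij.
by rewrite !mxE lG ?(ltnW ij) // -val_eqE /= ltn_eqF // addr0.
Qed.

Lemma node_mx_diag (mu : r.+1.-tuple C) G i :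
  strictly_lower r.+1 G -> node_mx mu G i i = tnth mu i.
Proof. by move=> lG; rewrite !mxE eqxx lG // addr0. Qed.

(** Used to see that a triangular similarity stays within the family and changes only the strictly
    lower parameters. *)
Lemma node_mxP (mu : r.+1.-tuple C) (A : 'M[C]_r.+1) : is_trig_mx A ->
    (forall i, A i i = tnth mu i) ->
  exists2 G, strictly_lower r.+1 G & A = node_mx mu G.
Proof.
move=> tA dA; exists (A - diag_mx (\row_i tnth mu i)); last first.
  by rewrite /node_mx addrC subrK.
move=> i k; rewrite leq_eqVlt => /predU1P[/val_inj->|ik].
  by rewrite !mxE eqxx dA subrr.
by rewrite !mxE (is_trig_mxP tA) // -val_eqE /= ltn_eqF // subr0.
Qed.

Lemma trig_1D_unit (E : 'M[C]_r.+1) (t : R) : is_trig_mx E -> 0 < t ->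
    t * (\sum_i normc (E i i)) < 1 ->
  is_trig_mx (1%:M + t%:C%C *: E) /\ 1%:M + t%:C%C *: E \in unitmx.
Proof.
move=> tE t0 tm; have tS : is_trig_mx (1%:M + t%:C%C *: E).
  apply/is_trig_mxP => i j ij.
  by rewrite !mxE (is_trig_mxP tE) // mulr0 -val_eqE /= ltn_eqF // addr0.
split => //; rewrite unitmxE unitfE det_trig //; apply/prodf_neq0 => i _.
rewrite !mxE eqxx; apply/negP => /eqP/(canRL (addKr _)).
rewrite addr0 => /(congr1 (fun z : C => normc z)); rewrite ComplexField.Normc.normcM.
have -> : normc (- 1%:R : C) = 1 by rewrite /= oppr0 expr0n /= addr0 sqrrN expr1n sqrtr1.
have -> : normc (t%:C%C : C) = t.
  by rewrite /= expr0n /= addr0 sqrtr_sqr ger0_norm // ltW.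
move=> tEi; move: tm; rewrite (bigD1 i) //= mulrDr tEi ltNge lerDl.
by rewrite mulr_ge0 ?(ltW t0) // sumr_ge0 // => j _; exact: normc_ge0.
Qed.

Variables (mu : r.+1.-tuple C) (G : 'M[C]_r.+1) (P : 'M[{poly C}]_n).
Hypotheses (n_gt0 : (0 < n)%N) (lowG : strictly_lower r.+1 G).
Let Q := Qmx mu G P.
Let sigma := sigma_min r.+1 Q.
Hypothesis maxG : forall G', strictly_lower r.+1 G' ->
  sigma_min r.+1 (Qmx mu G' P) <= sigma.
Hypothesis multG : multiplicity_assumption mu G P.

Lemma simple_index : exists2 i0, sval Q i0 = sigma &
  forall i, sval Q i = sigma -> i = i0.
Proof.
have /eqP := multG; rewrite -/Q -/sigma singular_valuesE.
rewrite (permP (permEl (perm_sort <=%R _))) card_sval.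
case/card1P => i0 i0P; have P1 i : (sval Q i == sigma) = (i == i0) by exact: i0P.
by exists i0 => [|i /eqP]; [apply/eqP; rewrite P1 | rewrite P1 => /eqP].
Qed.

Variable i0 : 'I_N.
Hypotheses (si0 : sval Q i0 = sigma) (uniq_i0 : forall i, sval Q i = sigma -> i = i0).
Let V : 'cV[C]_N := (svec Q)^t* *m delta_mx i0 0.

(* [kronmx E 1%:M] is the derivative at [0] of the similarity by [1 + t E], which
   preserves the diagonal [mu]. *)
Lemma rform_optimal_le (E : 'M[C]_r.+1) : is_trig_mx E ->
  rform (kronmx E 1%:M) (Q *m V) <= sigma ^+ 2 * rform (kronmx E 1%:M) V.
Proof.
move=> tE; rewrite leNgt; apply/negP => lt_rform.
have m0 : 0 <= \sum_i normc (E i i) by apply: sumr_ge0 => i _; exact: normc_ge0.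
have [t [t0 tm tP]] := sigma_min_perturb (ltn0Sn r) (leq_dim n_gt0) si0 uniq_i0 m0 lt_rform.
have [tS uS] := trig_1D_unit tE t0 tm; set S := 1%:M + _ in tS uS.
have SE : 1%:M + t%:C%C *: kronmx E 1%:M = kronmx S (1%:M : 'M[C]_n).
  by rewrite kronmxDl kronmxZl kronmx1.
have tN := trig_node_mx mu lowG.
have [G' lG' NE] : exists2 G', strictly_lower r.+1 G' &
    S *m node_mx mu G *m invmx S = node_mx mu G'.
  apply: node_mxP => [|i].
    by rewrite !trig_mulmx // trig_invmx.
  by rewrite trig_conj_diag // node_mx_diag.
have := maxG lG'; apply/negP; rewrite -ltNge.
have QE : Qmx mu G' P = kronmx S 1%:M *m Q *m kronmx (invmx S) 1%:M.
  by rewrite /Q (Qmx_mxpoly_at mu P lG') (Qmx_mxpoly_at mu P lowG) -NE mxpoly_at_conj.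
rewrite QE.
(* The test conditions exclude the smaller singular directions of [Q], pulled back by the inverse
   similarity. With $y = (S^{-1} \otimes I)x$ the required inequality is the one of
   [sigma_min_perturb]. *)
apply: (@lt_sigma_min _ _ _ _ (ltn0Sn r) (leq_dim n_gt0) _
  (scoords Q (fun s => s < sigma) *m kronmx (invmx S) 1%:M)).
- exact: sigma_min_ge0 (ltn0Sn r) (leq_dim n_gt0).
- apply: leq_ltn_trans (mxrankM_maxl _ _) (leq_ltn_trans (rank_scoords _ _) _).
  exact: card_sval_lt (ltn0Sn r) (leq_dim n_gt0).
move=> x x0; rewrite -!mulmxA; set y := _ *m x => sy.
have xE : x = kronmx S 1%:M *m y.
  by rewrite /y mulmxA mul_kronmx mulmxV // mulmx1 kronmx1 mul1mx.
have y0 : y != 0 by apply: contraNneq x0 => y0; rewrite xE y0 mulmx0.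
by have := tP y y0 sy; rewrite SE -xE.
Qed.

(** The admissible directions are closed under negation, so the first-order inequality for [E] and
    [- E] is an equality. *)
Lemma rform_optimal (E : 'M[C]_r.+1) : is_trig_mx E ->
  rform (kronmx E 1%:M) (Q *m V) = sigma ^+ 2 * rform (kronmx E 1%:M) V.
Proof.
move=> tE; apply/le_anti; rewrite rform_optimal_le //=.
have tNE : is_trig_mx (- E).
  by apply/is_trig_mxP => i j ij; rewrite mxE (is_trig_mxP tE) // oppr0.
have := rform_optimal_le tNE.
have -> : kronmx (- E) 1%:M = - kronmx E (1%:M : 'M[C]_n).
  by rewrite -scaleN1r kronmxZl scaleN1r.
by rewrite !rformN mulrN lerN2.
Qed.

(** After cancelling [sigma ^+ 2], stationarity says that the Hermitian difference [D] of the Gram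
    matrices is orthogonal to all lower triangular matrices. Its lower part vanishes, and the upper
    part follows by symmetry. *)
Lemma gram_eq (U W : 'M[C]_(n, r.+1)) : 0 < sigma -> V = vec W ->
  Q *m V = sigma%:C%C *: vec U -> U^t* *m U = W^t* *m W.
Proof.
move=> s0 VE QV; pose D := U^t* *m U - W^t* *m W.
have trD (E : 'M[C]_r.+1) : is_trig_mx E -> Re (\tr (D *m E^T)) = 0.
  move=> tE; have := rform_optimal tE; rewrite QV.
  have -> H : rform H (sigma%:C%C *: vec U) = sigma ^+ 2 * rform H (vec U).
    rewrite /rform conjmxZ -!scalemxAl -scalemxAr scalerA mxE [_^*]conjc_real.
    by rewrite -rmorphM /= -expr2 Re_mul_real.
  move/(mulfI (lt0r_neq0 (exprn_gt0 2 s0))).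
  rewrite VE !rform_kronmx_vec /D mulmxBl !raddfB /= => ->.
  by rewrite subrr.
have DJ : D^t* = D.
  rewrite /D conjmxD !conjmxM !trmxCK; congr (_ + _).
  by rewrite -[- _]scaleN1r conjmxZ conjmxM trmxCK rmorphN1 scaleN1r.
have Dlow (i k : 'I_r.+1) : (k <= i)%N -> D i k = 0.
  (* With this [E] the trace is the sum of the [`|D a b| ^+ 2] for [b <= a]. *)
  pose E : 'M[C]_r.+1 := \matrix_(i, k) if (k <= i)%N then (D i k)^* else 0.
  have tE : is_trig_mx E by apply/is_trig_mxP => a b ab; rewrite mxE leqNgt ab.
  have := trD E tE.
  have -> : \tr (D *m E^T) =
      (\sum_(a < r.+1) \sum_(b < r.+1 | (b <= a)%N) normc (D a b) ^+ 2)%:C%C.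
    rewrite rmorph_sum; apply: eq_bigr => a _; rewrite mxE rmorph_sum /= [RHS]big_mkcond.
    apply: eq_bigr => b _; rewrite !mxE; case: ifP => _; rewrite ?mulr0 //.
    by rewrite normc_sqr mulrC.
  move=> /= /eqP; rewrite psumr_eq0; last first.
    by move=> a _; apply: sumr_ge0 => b _; exact: sqr_ge0.
  move=> /allP/(_ i (mem_index_enum _)); rewrite psumr_eq0; last first.
    by move=> b _; exact: sqr_ge0.
  move=> /allP/(_ k (mem_index_enum _)) /implyP h ki; have := h ki.
  by rewrite expf_eq0 => /eqP; exact: ComplexField.Normc.eq0_normc.
apply/eqP; rewrite -subr_eq0 -/D; apply/eqP/matrixP => i k; rewrite [RHS]mxE.
have [/Dlow //|ik] := leqP k i.
have -> : D i k = (D k i)^* by rewrite -{1}DJ [LHS]mxE [D^T _ _]mxE.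
by rewrite Dlow ?(ltnW ik) // conjC0.
Qed.

End Optimality.

(** * Assembly *)

Section Regularity.
Variable F : numFieldType.

(** Regularity of $P + \Delta$, without which divisibility of the determinant would say nothing
    about multiplicities. *)
Lemma det_polynomial_neq0 n m (A : 'I_m.+1 -> 'M[F]_n) (D : 'M[F]_n) :
    (0 < m)%N -> A ord_max \in unitmx ->
  \det (\sum_(j < m.+1) 'X^j *: map_mx polyC (A j) + map_mx polyC D) != 0.
Proof.
move=> m0 uA; set P := _ + _.
(* The reversed matrix polynomial has the value [A ord_max] at [0]. *)
pose rev := \sum_(j < m.+1) 'X^(m - j) *: map_mx polyC (A j) + 'X^m *: map_mx polyC D.
have revE e : map_mx (horner_eval e) rev =
    \sum_(j < m.+1) e ^+ (m - j) *: A j + e ^+ m *: D.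
  rewrite raddfD raddf_sum /=; congr (_ + _).
    apply: eq_bigr => j _; apply/matrixP => a b.
    by rewrite !mxE /horner_eval hornerM hornerXn hornerC.
  by apply/matrixP => a b; rewrite !mxE /horner_eval hornerM hornerXn hornerC.
have PE e : map_mx (horner_eval e) P = \sum_(j < m.+1) e ^+ j *: A j + D.
  rewrite raddfD raddf_sum /= map_polyC_horner_eval; congr (_ + _).
  apply: eq_bigr => j _; apply/matrixP => a b.
  by rewrite !mxE /horner_eval hornerM hornerXn hornerC.
have d0 : \det rev != 0.
  apply/eqP => /(congr1 (horner_eval 0)); rewrite -det_map_mx revE.
  (* Since [0 < m], the perturbation [D] does not reach the leading coefficient. *)
  rewrite big_ord_recr /= subnn expr0 scale1r expr0n gtn_eqF // scale0r addr0.
  rewrite big1 ?add0r => [|j _]; last first.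
    by rewrite expr0n subn_eq0 leqNgt ltn_ord scale0r.
  by apply/eqP; rewrite /horner_eval horner0 -unitfE -unitmxE.
have X0 : ('X : {poly F}) != 0 by rewrite polyX_eq0.
have [e] := exists_nonroot (mulf_neq0 d0 X0).
rewrite rootM negb_or rootX => /andP[re e0]; apply: contraNneq re => dP0.
have revPe : map_mx (horner_eval e) rev = e ^+ m *: map_mx (horner_eval e^-1) P.
  rewrite revE PE scalerDr scaler_sumr; congr (_ + _); apply: eq_bigr => j _.
  by rewrite scalerA exprVn -expfB_cond // (negbTE e0) add0n -ltnS ltn_ord.
have := det_map_mx (horner_eval e) rev; rewrite revPe detZ det_map_mx dP0.
by rewrite rmorph0 mulr0 => /esym/eqP.
Qed.

End Regularity.

Section Assembly.
Variable R : realType.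
Local Notation C := R[i].
Local Notation normc := ComplexField.Normc.normc.

Lemma l2norm_le_opnorm2 n (D : 'M[C]_n) y : l2norm y = 1 ->
  l2norm (D *m y) <= opnorm2 D.
Proof.
move=> y1; apply: ub_le_sup; last by exists y.
have [K K0 KE] := nsq_bound D.
exists (Num.sqrt K) => _ [z z1 <-]; rewrite l2norm_nsq ler_wsqrtr //.
by apply: le_trans (KE z) _; rewrite -l2norm_sqr z1 expr1n mulr1.
Qed.

Lemma nsq_opnorm2 n (D : 'M[C]_n) x : nsq (D *m x) <= opnorm2 D ^+ 2 * nsq x.
Proof.
have [->|x0] := eqVneq x 0.
  by rewrite mulmx0 nsq0 mulr0.
have lx : 0 < l2norm x by rewrite sqrtr_gt0 nsq_gt0.
pose y := ((l2norm x)^-1)%:C%C *: x.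
have nl : normc (((l2norm x)^-1)%:C%C : C) = (l2norm x)^-1.
  by rewrite /= expr0n /= addr0 sqrtr_sqr ger0_norm // invr_ge0 ltW.
have ly z : nsq (((l2norm x)^-1)%:C%C *: z) = nsq z / nsq x.
  by rewrite nsqZ nl exprVn l2norm_sqr mulrC.
have y1 : l2norm y = 1.
  by rewrite l2norm_nsq ly divff ?sqrtr1 // nsq_eq0.
have := l2norm_le_opnorm2 D y1; rewrite -scalemxAr => h.
have : l2norm (((l2norm x)^-1)%:C%C *: (D *m x)) ^+ 2 <= opnorm2 D ^+ 2.
  by rewrite ler_sqr ?nnegrE ?l2norm_ge0 // (le_trans _ h) // l2norm_ge0.
by rewrite l2norm_sqr ly ler_pdivrMr ?nsq_gt0.
Qed.

Lemma opnorm2_ge0 n (D : 'M[C]_n) : (0 < n)%N -> 0 <= opnorm2 D.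
Proof.
move=> n0; apply: le_trans (l2norm_ge0 _) (l2norm_le_opnorm2 D _).
exact: l2norm_delta (Ordinal n0).
Qed.

Lemma opnorm2_le n (D : 'M[C]_n) (c : R) : (0 < n)%N -> 0 <= c ->
  (forall x, nsq (D *m x) <= c ^+ 2 * nsq x) -> opnorm2 D <= c.
Proof.
move=> n0 c0 Dc; apply: ge_sup.
  pose x := delta_mx (Ordinal n0) 0 : 'cV[C]_n.
  by exists (l2norm (D *m x)), x => //; exact: l2norm_delta.
move=> _ [x x1 <-]; rewrite -ler_sqr ?nnegrE ?l2norm_ge0 // l2norm_sqr.
by apply: le_trans (Dc x) _; rewrite -l2norm_sqr x1 expr1n mulr1.
Qed.

Lemma nsq_kronmx1 n r (D : 'M[C]_n) (d : R) :
  (forall x, nsq (D *m x) <= d * nsq x) ->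
  forall v, nsq (kronmx (1%:M : 'M[C]_r.+1) D *m v) <= d * nsq v.
Proof.
move=> Dd v; rewrite -(unvecK v) kronmx_vec trmx1 mulmx1 !nsq_vec mulr_sumr.
by apply: ler_sum => l _; rewrite colE -mulmxA -colE.
Qed.

(** [L] is the Moore-Penrose inverse of [W]. Equal Gram matrices give $\|ULx\| = \|WLx\|$, the norm
    of an orthogonal projection of $x$. *)
Lemma nsq_contraction n r (U W : 'M[C]_(n, r)) : \rank W = r ->
    U^t* *m U = W^t* *m W ->
  exists2 L : 'M[C]_(r, n), L *m W = 1%:M & forall x, nsq (U *m (L *m x)) <= nsq x.
Proof.
move=> rW UW; pose G := W^t* *m W.
have GJ : G^t* = G by rewrite conjmxM trmxCK.
have uG : G \in unitmx.
  rewrite -unitmx_tr -row_free_unit; apply: inj_row_free => v vG.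
  have Wv : W *m v^T = 0.
    apply/eqP; rewrite -nsq_eq0 nsqM /rform -mulmxA -/G.
    have -> : G *m v^T = 0 by apply: trmx_inj; rewrite trmx_mul trmxK vG trmx0.
    by rewrite mulmx0 mxE.
  have fW : row_free W^T by rewrite /row_free mxrank_tr rW.
  apply: (row_free_inj fW); rewrite mul0mx.
  by apply: trmx_inj; rewrite trmx_mul trmxK Wv trmx0.
(* [W *m L] is the orthogonal projection on the column space of [W]. *)
pose L := invmx G *m W^t*; have LW : L *m W = 1%:M by rewrite -mulmxA mulVmx.
exists L => // x; pose Pi := W *m L.
have PiJ : Pi^t* = Pi.
  by rewrite /Pi /L !conjmxM trmxCK trmx_inv map_invmx GJ mulmxA.
have PiP : Pi *m Pi = Pi by rewrite /Pi -mulmxA (mulmxA L) LW mul1mx.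
have -> : nsq (U *m (L *m x)) = nsq (Pi *m x).
  by rewrite nsqM UW -/G -nsqM mulmxA.
have E1 : nsq (Pi *m x) = rform Pi x by rewrite nsqM PiJ PiP.
have E2 : nsq ((1%:M - Pi) *m x) = nsq x - nsq (Pi *m x).
  rewrite [LHS]nsqM conjmxD conjmx1 -[- Pi]scaleN1r conjmxZ PiJ rmorphN1.
  rewrite scaleN1r mulmxBr mulmx1 mulmxBl mul1mx PiP subrr subr0.
  by rewrite rformD rformN E1 nsq_rform.
by rewrite -subr_ge0 -E2 nsq_ge0.
Qed.

Lemma ker_alg_mult n r (P : 'M[{poly C}]_n) (mu : r.+1.-tuple C) (G : 'M[C]_r.+1)
    (W : 'M[C]_(n, r.+1)) (S : seq C) : uniq S -> {subset mu <= S} ->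
    strictly_lower r.+1 G -> \rank W = r.+1 -> \det P != 0 ->
    mxpoly_at (node_mx mu G) P *m vec W = 0 ->
  (r.+1 <= \sum_(x <- S) alg_mult P x)%N.
Proof.
move=> uS muS lG rW d0 PW.
have := dvdp_char_poly_det rW PW; rewrite char_poly_trig ?trig_node_mx //.
rewrite (eq_bigr (fun i => 'X - (tnth mu i)%:P)); last first.
  by move=> i _; rewrite node_mx_diag.
move=> dvd; rewrite -[X in (X <= _)%N](size_tuple mu); apply: leq_sum_mup => //.
by rewrite big_tuple.
Qed.

End Assembly.

(** * The lower bound and the optimal perturbation *)

Section Bounds.
Variable R : realType.
Local Notation C := R[i].
Local Notation normc := ComplexField.Normc.normc.

(** The nodes split off from $P + \Delta$ give the nullity for all [G] at once, hence bound the
    whole supremum at that [mu]. *)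
Lemma inf_sup_le_opnorm2 n r (P : 'M[{poly C}]_n) (S : seq C) (D : 'M[C]_n) :
    (0 < n)%N -> uniq S ->
    (r.+1 <= \sum_(x <- S) alg_mult (P + map_mx polyC D) x)%N ->
  (inf_sup_sigma r.+1 P S <= (opnorm2 D)%:E)%E.
Proof.
move=> n0 uS /(exists_rank_mxpoly_at n0 uS)[mu muS rk].
apply: (@le_trans _ _ (sup_sigma P mu)).
  by apply: ereal_inf_lbound; exists mu.
apply: ge_ereal_sup => _ [G lG <-]; rewrite lee_fin.
rewrite (Qmx_mxpoly_at mu P lG).
apply: (@sigma_min_le _ _ _ _ (ltn0Sn r) (leq_dim r n0) (kronmx 1%:M D)).
- exact: opnorm2_ge0.
- by move=> x; apply: nsq_kronmx1 => y; exact: nsq_opnorm2.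
rewrite -(mxpoly_atC (node_mx mu G)) -mxpoly_atD.
by apply: rk => [|i]; [exact: trig_node_mx | exact: node_mx_diag].
Qed.

Lemma exists_perturbation n r (P : 'M[{poly C}]_n) (mu : r.+1.-tuple C)
    (G : 'M[C]_r.+1) : (0 < n)%N -> strictly_lower r.+1 G ->
    (forall G', strictly_lower r.+1 G' ->
       sigma_min r.+1 (Qmx mu G' P) <= sigma_min r.+1 (Qmx mu G P)) ->
    multiplicity_assumption mu G P -> independence_assumption mu G P ->
  exists (D : 'M[C]_n) (W : 'M[C]_(n, r.+1)),
    [/\ \rank W = r.+1,
        mxpoly_at (node_mx mu G) (P + map_mx polyC D) *m vec W = 0
      & forall x, nsq (D *m x) <= sigma_min r.+1 (Qmx mu G P) ^+ 2 * nsq x].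
Proof.
move=> n0 lG maxG multG indG.
set Q := Qmx mu G P in maxG *; set sigma := sigma_min r.+1 Q in maxG *.
have [i0 si0 ui0] := simple_index multG.
have s0 : 0 <= sigma := sigma_min_ge0 Q (ltn0Sn r) (leq_dim r n0).
pose V : 'cV[C]_(\sum_(i < r.+1) n) := (svec Q)^t* *m delta_mx i0 0.
have V1 : l2norm V = 1 by exact: l2norm_svecV.
have gV : Q^t* *m Q *m V = (sigma ^+ 2)%:C%C *: V by apply: gram_svecV.
pose W := unvec V; have VW : V = vec W by rewrite unvecK.
have sJ : (sigma%:C%C : C)^* = sigma%:C%C by rewrite [LHS]conjc_real.
(* If [sigma] is 0, then $\Delta = 0$ serves. The left singular vector demanded by the independence
   assumption is then a normalized left null vector of [Q]. *)
have [sz|sp] := eqVneq sigma 0.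
  have QV0 : Q *m V = 0.
    apply/eqP; rewrite -nsq_eq0 nsqM /rform -mulmxA gV sz expr0n scale0r mulmx0.
    by rewrite mxE.
  have V0 : V != 0.
    by apply: contra_eq_neq V1 => ->; rewrite l2norm_nsq nsq0 sqrtr0 eq_sym oner_eq0.
  have [u u0 uQ] : exists2 u : 'rV[C]_(\sum_(i < r.+1) n), u != 0 & u *m Q = 0.
    apply/det0P; rewrite -det_tr; apply/det0P; exists V^T.
      by rewrite trmx_eq0.
    by rewrite -trmx_mul QV0 trmx0.
  pose U := ((l2norm (u^t*))^-1)%:C%C *: u^t*.
  have U1 : l2norm U = 1.
    have lu : 0 < l2norm (u^t*).
      rewrite sqrtr_gt0 nsq_gt0 //; apply: contra u0 => /eqP u0.
      by rewrite -(trmxCK u) u0 trmx0 map_mx0.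
    rewrite l2norm_nsq nsqZ /= expr0n /= addr0 sqrtr_sqr ger0_norm ?invr_ge0 ?ltW //.
    by rewrite -l2norm_sqr -exprMn mulVf ?gt_eqF // expr1n sqrtr1.
  exists 0, W; split.
  - apply: (indG U V) => //; rewrite -/Q -/sigma sz.
      by rewrite QV0 scale0r.
    by rewrite scale0r conjmxZ trmxCK -scalemxAl uQ scaler0.
  - by rewrite map_mx0 addr0 -(Qmx_mxpoly_at mu P lG) -VW.
  - by move=> x; rewrite mul0mx nsq0 mulr_ge0 ?sqr_ge0 ?nsq_ge0.
have s_gt0 : 0 < sigma by rewrite lt_neqAle eq_sym sp.
have sC0 : (sigma%:C%C : C) != 0 by rewrite (fmorph_eq0 (real_complex R)).
pose U := sigma%:C%C^-1 *: (Q *m V); pose Um := unvec U.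
have UE : U = vec Um := esym (unvecK U).
have QV : Q *m V = sigma%:C%C *: U by rewrite /U scalerA (divff sC0) scale1r.
have UQ : U^t* *m Q = sigma%:C%C *: V^t*.
  have -> : U^t* *m Q = (Q^t* *m U)^t* by rewrite conjmxM trmxCK.
  have e : sigma%:C%C^-1 * (sigma ^+ 2)%:C%C = sigma%:C%C :> C.
    by rewrite rmorphXn /= expr2 mulKf.
  by rewrite /U -scalemxAr mulmxA gV scalerA e conjmxZ sJ.
have U1 : l2norm U = 1.
  have QVn : nsq (Q *m V) = sigma ^+ 2.
    apply: (@complexI R); rewrite nsqE conjmxM mulmxA -[_ *m _ *m Q]mulmxA.
    rewrite -mulmxA gV -scalemxAr mxE -nsqE -l2norm_sqr V1 expr1n.
    by rewrite rmorph1 mulr1.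
  have sU : nsq (sigma%:C%C *: U) = sigma ^+ 2 by rewrite -QV.
  move: sU; rewrite nsqZ.
  have -> : normc (sigma%:C%C : C) ^+ 2 = sigma ^+ 2.
    by rewrite /= expr0n /= addr0 sqrtr_sqr ger0_norm.
  rewrite -[RHS]mulr1 => /(mulfI (lt0r_neq0 (exprn_gt0 2 s_gt0))) U2.
  by rewrite l2norm_nsq U2 sqrtr1.
have rW : \rank W = r.+1 by apply: (indG U V).
have gram : Um^t* *m Um = W^t* *m W.
  by apply: (gram_eq n0 lG maxG si0 ui0 s_gt0 VW); rewrite -UE.
have [L LW Lc] := nsq_contraction rW gram.
(* As [L] is a left inverse of [W], this $\Delta$ maps [W] to [- sigma *: Um], which cancels $QV =
   \sigma U$. *)
exists (- sigma%:C%C *: (Um *m L)), W; split => //.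
  rewrite mxpoly_atD mxpoly_atC -(Qmx_mxpoly_at mu P lG) -/Q mulmxDl.
  rewrite kronmx_vec trmx1 mulmx1 -scalemxAl -mulmxA LW mulmx1 vecZ -UE -VW QV.
  by rewrite scaleNr subrr.
move=> x; rewrite -scalemxAl nsqZ -mulmxA.
have -> : normc (- sigma%:C%C : C) ^+ 2 = sigma ^+ 2.
  by rewrite /= oppr0 expr0n /= addr0 sqrtr_sqr normrN ger0_norm.
by rewrite ler_wpM2l ?sqr_ge0.
Qed.

End Bounds.

Theorem theorem3p3 (R : realType) (n m s r : nat)
    (hn : (0 < n)%N) (hm : (1 <= m)%N) (hr : (0 < r)%N)
    (A : 'I_m.+1 -> 'M[R[i]]_n) (hA : \rank (A ord_max) = n)
    (S : s.-tuple R[i]) (hS : uniq S)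
    (mus : r.-tuple R[i]) (hmus : tuples_in r S mus)
    (hmin : sup_sigma (mxpoly_of A) mus = inf_sup_sigma r (mxpoly_of A) S)
    (Gs : 'M[R[i]]_r) (hGs : strictly_lower r Gs)
    (hmax : (sigma_min r (Qmx mus Gs (mxpoly_of A)))%:E
            = sup_sigma (mxpoly_of A) mus)
    (hmult : multiplicity_assumption mus Gs (mxpoly_of A))
    (hind : independence_assumption mus Gs (mxpoly_of A)) :
  tau (mxpoly_of A) S r = inf_sup_sigma r (mxpoly_of A) S.
Proof.
case: r hr mus hmus hmin Gs hGs hmax hmult hind => // r _ mu muS hmin G lG.
move=> hmax hmult hind.
set P := mxpoly_of A in hmin hmax hmult hind *.
have maxG G' : strictly_lower r.+1 G' ->
    sigma_min r.+1 (Qmx mu G' P) <= sigma_min r.+1 (Qmx mu G P).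
  by move=> lG'; rewrite -lee_fin [leRHS]hmax; apply: ereal_sup_ubound; exists G'.
have [D [W [rW PW Dle]]] := exists_perturbation hn lG maxG hmult hind.
have s0 := sigma_min_ge0 (Qmx mu G P) (ltn0Sn r) (leq_dim r hn).
apply/eqP; rewrite eq_le; apply/andP; split.
  (* By attainment the right-hand side is the singular value at the optimum, and [D] is an
     admissible perturbation of at most that norm. *)
  rewrite -hmin -hmax; apply: (@le_trans _ _ (opnorm2 D)%:E).
    apply: ereal_inf_lbound; exists D => //=.
    apply: (ker_alg_mult hS muS lG rW _ PW).
    by apply: det_polynomial_neq0 => //; rewrite -row_full_unit /row_full hA.
  by rewrite lee_fin opnorm2_le.
apply: le_ereal_inf_tmp => _ [E mE <-].
exact: inf_sup_le_opnorm2.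
Qed.
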